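(* Let $V$ be a complex Hilbert space, $\Omega\subset\mathbb C$ open, and let $P:\Omega\to\mathrm{End}^+V$ be a $C^\infty$ map, determining the smooth hermitian metric $h(z,u,v)=\langle P(z)u,v\rangle$ on the trivial bundle $\Omega\times V\to\Omega$. Then the metric has seminegative curvature if and only if for every disc $\{z\in\mathbb C:|z-a|\le r\}$ contained in $\Omega$ $$\int_{|z-a|=r}P\,|dz|-\int_{|z-a|=r}P\,dz\left(\int_{|z-a|=r}P\,|dz|\right)^{-1}\int_{|z-a|=r}P\,d\overline z\ \ge\ 2\pi r\,P(a).$$ If the curvature is seminegative, then the left hand side of this inequality, divided by $r$, is an increasing function of $r$ (for fixed $a$, with $r$ ranging over the values for which the closed disc $\{|z-a|\le r\}$ is contained in $\Omega$).
   Context: $\mathrm{End}\,V$ is the space of continuous linear operators on $V$ and $\mathrm{End}^+V$ the cone of positive (self-adjoint) invertible operators. Smoothness is with respect to the operator norm. $|dz|$ refers to integration with respect to arc length. Inequalities between self-adjoint operators are in the usual operator order, and ''increasing'' means nondecreasing in this order. The metric given by $P$ has seminegative curvature if $P_{\overline z}P^{-1}P_z-P_{z\overline z}\le 0$ on $\Omega$, where subscripts denote partial derivatives. *)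

(* Defs.v *)
From Stdlib Require Import Reals Lra ClassicalEpsilon.
From Stdlib Require Import ProofIrrelevance FunctionalExtensionality PropExtensionality.
From Coquelicot Require Import Coquelicot.

Set Implicit Arguments.
Unset Strict Implicit.
Unset Printing Implicit Defensive.

Open Scope R_scope.

(* Linear in the first variable.  The norm is the one of the underlying complete
   normed module, so completeness refers to the norm given by [inner]. *)
Record HilbertSpace := {
  hilbert_carrier :> CompleteNormedModule C_AbsRing;
  inner : hilbert_carrier -> hilbert_carrier -> C;
  inner_plus_l : forall u v w, inner (plus u v) w = Cplus (inner u w) (inner v w);
  inner_scal_l : forall (c : C) u v, inner (scal c u) v = Cmult c (inner u v);
  inner_sym : forall u v, inner v u = Cconj (inner u v);
  inner_norm : forall u, inner u u = RtoC (norm u ^ 2)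
}.

Lemma minus_plus_plus (G : AbelianGroup) (a b c d : G) :
  minus (plus a b) (plus c d) = plus (minus a c) (minus b d).
Proof.
  unfold minus; rewrite opp_plus, <- !plus_assoc; f_equal.
  rewrite !plus_assoc; f_equal; apply plus_comm.
Qed.

Section Operators.

Variable V : CompleteNormedModule C_AbsRing.

(* Norm lemmas at the coercion path through [CompleteNormedModule]. *)
Lemma norm0V : norm (zero : V) = 0.
Proof. exact (@norm_zero C_AbsRing V). Qed.

Lemma normNV (x : V) : norm (opp x) = norm x.
Proof. exact (@norm_opp C_AbsRing V x). Qed.

Lemma normDV (x y : V) : norm (plus x y) <= norm x + norm y.
Proof. exact (@norm_triangle C_AbsRing V x y). Qed.

Lemma normZV (c : C_AbsRing) (x : V) : norm (scal c x) <= Cmod c * norm x.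
Proof. exact (@norm_scal C_AbsRing V c x). Qed.

Lemma norm_eq0V (x : V) : norm x = 0 -> x = zero.
Proof. exact (@norm_eq_zero C_AbsRing V x). Qed.

Lemma distV (b a c : V) : norm (minus a c) <= norm (minus b a) + norm (minus b c).
Proof.
  rewrite <- (normNV (minus b a)), (@opp_minus V b a), (@minus_trans V b a c).
  apply normDV.
Qed.

Lemma dist_plusV (a b c d : V) :
  norm (minus (plus a b) (plus c d)) <= norm (minus a c) + norm (minus b d).
Proof.
  replace (minus (plus a b) (plus c d)) with (plus (minus a c) (minus b d));
    [apply normDV|].
  symmetry; exact (@minus_plus_plus V a b c d).
Qed.

Lemma dist_scalV (c : C_AbsRing) (a b : V) :
  norm (minus (scal c a) (scal c b)) <= Cmod c * norm (minus a b).
Proof.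
  replace (minus (scal c a) (scal c b)) with (scal c (minus a b)); [apply normZV|].
  apply (@scal_minus_distr_l C_AbsRing V).
Qed.

Record BoundedOp := MkBoundedOp {
  bop_fun :> V -> V;
  bop_linear : is_linear bop_fun
}.

Lemma bop_ext (A B : BoundedOp) : (forall x, A x = B x) -> A = B.
Proof.
  destruct A as [A HA], B as [B HB]; simpl; intros H.
  assert (E : A = B) by (apply functional_extensionality; exact H).
  subst B; f_equal; apply proof_irrelevance.
Qed.

Lemma bop_plus_linear (A B : BoundedOp) : is_linear (fun x => plus (A x) (B x)).
Proof.
  apply (@is_linear_comp C_AbsRing V (prod_NormedModule _ V V) V
           (fun x => (A x, B x)) (fun p => plus (fst p) (snd p))).
  - apply is_linear_prod; apply bop_linear.
  - apply is_linear_plus.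
Qed.

Lemma bop_scal_linear (c : C) (A : BoundedOp) : is_linear (fun x => scal c (A x)).
Proof.
  apply (@is_linear_comp C_AbsRing V V V A (fun y : V => scal c y)).
  - apply bop_linear.
  - apply (@is_linear_scal_r C_AbsRing V c); exact Cmult_comm.
Qed.

Lemma bop_opp_linear (A : BoundedOp) : is_linear (fun x => opp (A x)).
Proof.
  apply (@is_linear_comp C_AbsRing V V V A opp);
    [apply bop_linear | apply is_linear_opp].
Qed.

Lemma bop_at_zero (A : BoundedOp) : A zero = zero.
Proof. exact (linear_zero _ (bop_linear A)). Qed.

Lemma bop_at_plus (A : BoundedOp) x y : A (plus x y) = plus (A x) (A y).
Proof. exact (linear_plus _ (bop_linear A) x y). Qed.

Lemma bop_at_scal (A : BoundedOp) (c : C_AbsRing) x : A (scal c x) = scal c (A x).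
Proof. exact (linear_scal _ (bop_linear A) c x). Qed.

Definition bop_zero : BoundedOp := MkBoundedOp is_linear_zero.
Definition bop_one : BoundedOp := MkBoundedOp is_linear_id.
Definition bop_plus (A B : BoundedOp) : BoundedOp := MkBoundedOp (bop_plus_linear A B).
Definition bop_opp (A : BoundedOp) : BoundedOp := MkBoundedOp (bop_opp_linear A).
Definition bop_cscal (c : C) (A : BoundedOp) : BoundedOp := MkBoundedOp (bop_scal_linear c A).
Definition bop_comp (A B : BoundedOp) : BoundedOp :=
  MkBoundedOp (is_linear_comp B A (bop_linear B) (bop_linear A)).

Definition op_norm (A : BoundedOp) : R :=
  real (Lub_Rbar (fun y => exists x : V, norm x <= 1 /\ y = norm (A x))).

Lemma op_norm_lub (A : BoundedOp) :
  is_lub_Rbar (fun y => exists x : V, norm x <= 1 /\ y = norm (A x)) (op_norm A).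
Proof.
  unfold op_norm.
  set (E := fun y => exists x : V, norm x <= 1 /\ y = norm (A x)).
  pose proof (Lub_Rbar_correct E) as [Hub Hlub].
  destruct (linear_norm _ (bop_linear A)) as [M [HM HA]].
  assert (H1 : Rbar_le (Lub_Rbar E) M).
  { apply Hlub; intros y [x [Hx ->]]; simpl.
    eapply Rle_trans; [apply HA|].
    rewrite <- (Rmult_1_r M) at 2; apply Rmult_le_compat_l; lra. }
  assert (H0 : Rbar_le 0 (Lub_Rbar E)).
  { apply Hub; exists zero.
    rewrite bop_at_zero, norm0V.
    split; [lra | reflexivity]. }
  destruct (Lub_Rbar E) as [l | |]; simpl in *; try contradiction.
  split; [exact Hub | exact Hlub].
Qed.

Lemma op_norm_ge0 (A : BoundedOp) : 0 <= op_norm A.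
Proof.
  destruct (op_norm_lub A) as [Hub _].
  apply (Hub 0); exists zero.
  rewrite bop_at_zero, norm0V.
  split; [lra | reflexivity].
Qed.

Lemma op_norm_bound (A : BoundedOp) (x : V) : norm (A x) <= op_norm A * norm x.
Proof.
  destruct (Req_dec (norm x) 0) as [H0 | H0].
  { rewrite H0, (norm_eq0V H0), bop_at_zero, norm0V; lra. }
  pose proof (norm_ge_0 x) as Hx.
  set (y := scal (RtoC (/ norm x) : C_AbsRing) x).
  assert (Hinv : 0 < / norm x) by (apply Rinv_0_lt_compat; lra).
  assert (Hy : norm y <= 1).
  { eapply Rle_trans; [apply normZV|].
    rewrite Cmod_R, Rabs_pos_eq by lra; right; field; lra. }
  assert (Hxy : x = scal (RtoC (norm x) : C_AbsRing) y).
  { unfold y; rewrite scal_assoc; change (@mult C_AbsRing) with Cmult.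
    rewrite <- RtoC_mult, Rinv_r by exact H0.
    symmetry; apply (@scal_one C_AbsRing). }
  destruct (op_norm_lub A) as [Hub _].
  assert (Hn : norm (A y) <= op_norm A) by (apply (Hub (norm (A y))); exists y; auto).
  rewrite Hxy at 1; rewrite bop_at_scal.
  eapply Rle_trans; [apply normZV|].
  rewrite Cmod_R, Rabs_pos_eq by lra.
  rewrite Rmult_comm; apply Rmult_le_compat_r; assumption.
Qed.

Lemma op_norm_le (A : BoundedOp) (M : R) :
  0 <= M -> (forall x, norm (A x) <= M * norm x) -> op_norm A <= M.
Proof.
  intros HM H; destruct (op_norm_lub A) as [_ Hlub].
  apply (Hlub M); intros y [x [Hx ->]]; simpl.
  eapply Rle_trans; [apply H|].
  rewrite <- (Rmult_1_r M) at 2; apply Rmult_le_compat_l; lra.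
Qed.

Lemma op_norm_triangle (A B : BoundedOp) : op_norm (bop_plus A B) <= op_norm A + op_norm B.
Proof.
  pose proof (op_norm_ge0 A); pose proof (op_norm_ge0 B).
  apply op_norm_le; [lra|]; intros x; simpl.
  eapply Rle_trans; [apply normDV|].
  pose proof (op_norm_bound A x); pose proof (op_norm_bound B x); lra.
Qed.

Lemma op_norm_cscal (c : C) (A : BoundedOp) : op_norm (bop_cscal c A) <= Cmod c * op_norm A.
Proof.
  apply op_norm_le.
  - apply Rmult_le_pos; [apply Cmod_ge_0 | apply op_norm_ge0].
  - intros x; simpl; eapply Rle_trans; [apply normZV|].
    rewrite Rmult_assoc.
    apply Rmult_le_compat_l; [apply Cmod_ge_0 | apply op_norm_bound].
Qed.

Lemma op_norm_eq0 (A : BoundedOp) : op_norm A = 0 -> A = bop_zero.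
Proof.
  intros H; apply bop_ext; intros x; simpl; apply norm_eq0V.
  pose proof (op_norm_bound A x); pose proof (norm_ge_0 (A x)).
  rewrite H in *; lra.
Qed.

Definition bop_AbelianMonoid_mixin : AbelianMonoid.mixin_of BoundedOp.
Proof.
  apply (@AbelianMonoid.Mixin BoundedOp bop_plus bop_zero);
    intros; apply bop_ext; intros t; simpl.
  - apply plus_comm.
  - apply plus_assoc.
  - apply plus_zero_r.
Defined.

Canonical bop_AbelianMonoid := AbelianMonoid.Pack BoundedOp bop_AbelianMonoid_mixin BoundedOp.

Definition bop_AbelianGroup_mixin : AbelianGroup.mixin_of bop_AbelianMonoid.
Proof.
  apply (@AbelianGroup.Mixin bop_AbelianMonoid bop_opp).
  intros A; apply bop_ext; intros t; apply (@plus_opp_r V).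
Defined.

Canonical bop_AbelianGroup :=
  AbelianGroup.Pack BoundedOp (AbelianGroup.Class BoundedOp _ bop_AbelianGroup_mixin) BoundedOp.

(* Only the real structure is made canonical: this is the one needed to
   differentiate and integrate along real variables. *)
Definition bop_ModuleSpace_mixin : ModuleSpace.mixin_of R_Ring bop_AbelianGroup.
Proof.
  apply (@ModuleSpace.Mixin R_Ring bop_AbelianGroup (fun r => bop_cscal (RtoC r)));
    intros; apply bop_ext; intros t; simpl.
  - rewrite (@scal_assoc C_AbsRing); f_equal; symmetry; apply RtoC_mult.
  - apply (@scal_one C_AbsRing).
  - apply (@scal_distr_l C_AbsRing).
  - change (@plus R_Ring x y) with (x + y); rewrite RtoC_plus.
    apply (@scal_distr_r C_AbsRing).
Defined.

Canonical bop_ModuleSpace :=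
  ModuleSpace.Pack R_Ring BoundedOp (ModuleSpace.Class R_Ring BoundedOp _ bop_ModuleSpace_mixin) BoundedOp.

Definition bop_ball (A : BoundedOp) (e : R) (B : BoundedOp) : Prop := op_norm (minus B A) < e.

Lemma bop_minus_apply (A B : BoundedOp) x : minus A B x = minus (A x) (B x).
Proof. reflexivity. Qed.

Definition bop_UniformSpace_mixin : UniformSpace.mixin_of BoundedOp.
Proof.
  apply (@UniformSpace.Mixin BoundedOp bop_zero bop_ball); unfold bop_ball.
  - intros A e; eapply Rle_lt_trans; [|apply (cond_pos e)].
    apply op_norm_le; [lra|]; intros x.
    rewrite bop_minus_apply, minus_eq_zero.
    replace (norm _) with 0 by (symmetry; exact norm0V); lra.
  - intros A B e H; eapply Rle_lt_trans; [|exact H].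
    apply op_norm_le; [apply op_norm_ge0|]; intros x.
    eapply Rle_trans; [|apply op_norm_bound].
    rewrite !bop_minus_apply, <- (opp_minus (B x) (A x)), normNV; apply Rle_refl.
  - intros A B D e1 e2 H1 H2.
    apply Rle_lt_trans with (op_norm (minus B A) + op_norm (minus D B)); [|lra].
    replace (minus D A) with (bop_plus (minus B A) (minus D B)).
    + apply op_norm_triangle.
    + change (plus (minus B A) (minus D B) = minus D A).
      rewrite plus_comm; symmetry; apply minus_trans.
Defined.

Canonical bop_UniformSpace := UniformSpace.Pack BoundedOp bop_UniformSpace_mixin BoundedOp.

Canonical bop_NormedModuleAux :=
  NormedModuleAux.Pack R_AbsRing BoundedOp
    (NormedModuleAux.Class R_AbsRing BoundedOp
       (ModuleSpace.class _ bop_ModuleSpace) bop_UniformSpace_mixin) BoundedOp.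

Definition bop_NormedModule_mixin : NormedModule.mixin_of R_AbsRing bop_NormedModuleAux.
Proof.
  apply (@NormedModule.Mixin R_AbsRing bop_NormedModuleAux op_norm 1).
  - exact op_norm_triangle.
  - intros r A; change (@abs R_AbsRing r) with (Rabs r); rewrite <- Cmod_R.
    apply (op_norm_cscal (RtoC r)).
  - intros A B e H; exact H.
  - intros A B e H; rewrite Rmult_1_l; exact H.
  - exact op_norm_eq0.
Defined.

Canonical bop_NormedModule :=
  NormedModule.Pack R_AbsRing BoundedOp
    (NormedModule.Class R_AbsRing BoundedOp
       (NormedModuleAux.class _ bop_NormedModuleAux) bop_NormedModule_mixin) BoundedOp.

Section Limit.

Variable F : (BoundedOp -> Prop) -> Prop.
Hypothesis FF : ProperFilter F.
Hypothesis cF : cauchy F.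

Let FFilter : Filter F := @filter_filter _ _ FF.

Lemma bop_cauchy2 (e : posreal) :
  exists A0 : BoundedOp, F (fun A => forall x, norm (minus (A x) (A0 x)) <= e * norm x).
Proof.
  destruct (cF e) as [A0 H0]; exists A0.
  revert H0; apply filter_imp; intros A HA x.
  change (op_norm (minus A A0) < e) in HA.
  rewrite <- bop_minus_apply; eapply Rle_trans; [apply op_norm_bound|].
  apply Rmult_le_compat_r; [apply norm_ge_0 | lra].
Qed.

Lemma bop_pointwise_cauchy (x : V) : cauchy (filtermap (fun A : BoundedOp => A x) F).
Proof.
  intros e; pose proof (norm_ge_0 x) as Hx.
  assert (Hd : 0 < e / (norm x + 1)) by (apply Rdiv_lt_0_compat; [apply cond_pos | lra]).
  destruct (bop_cauchy2 (mkposreal _ Hd)) as [A0 H0]; exists (A0 x).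
  unfold filtermap; revert H0; apply filter_imp; intros A HA; apply (@norm_compat1 C_AbsRing).
  eapply Rle_lt_trans; [apply HA|]; simpl.
  apply Rlt_le_trans with (e / (norm x + 1) * (norm x + 1)); [nra|].
  right; field; lra.
Qed.

Definition bop_limfun (x : V) : V := lim (filtermap (fun A : BoundedOp => A x) F).

Lemma bop_limfun_spec (x : V) (e : posreal) :
  F (fun A : BoundedOp => norm (minus (A x) (bop_limfun x)) < e).
Proof.
  pose proof (@norm_factor_gt_0 _ V) as Hf.
  assert (Hd : 0 < e / @norm_factor _ V) by (apply Rdiv_lt_0_compat; [apply cond_pos | lra]).
  assert (H := @complete_cauchy V _ (filtermap_proper_filter _ _ _ _ FF)
                 (bop_pointwise_cauchy x) (mkposreal _ Hd)).
  unfold filtermap in H; revert H; apply filter_imp; intros A HA.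
  apply (@norm_compat2 C_AbsRing V) in HA; simpl in HA.
  replace (pos e) with (@norm_factor _ V * (e / @norm_factor _ V)); [exact HA|].
  field; lra.
Qed.

Lemma norm_small (x : V) : (forall e : posreal, norm x <= e) -> x = zero.
Proof.
  intros H; apply norm_eq0V; apply Rle_antisym; [|apply norm_ge_0].
  apply le_epsilon; intros e He; rewrite Rplus_0_l; apply (H (mkposreal e He)).
Qed.

Lemma minus_zero_eq (x y : V) : minus x y = zero -> x = y.
Proof.
  intros H; apply (@plus_reg_r V (opp y)); rewrite plus_opp_r; exact H.
Qed.

Lemma bop_limfun_dist (e : posreal) (A0 : BoundedOp) :
  F (fun A => forall x, norm (minus (A x) (A0 x)) <= e * norm x) ->
  forall x, norm (minus (bop_limfun x) (A0 x)) <= e * norm x.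
Proof.
  intros H x; apply le_epsilon; intros d Hd.
  destruct (filter_ex _ (filter_and _ _ H (bop_limfun_spec x (mkposreal d Hd))))
    as [A [H1 H2]]; simpl in H2; specialize (H1 x).
  rewrite (minus_trans (A x)); eapply Rle_trans; [apply normDV|].
  rewrite <- (opp_minus (A x) (bop_limfun x)), normNV; lra.
Qed.

Lemma bop_limfun_linear : is_linear bop_limfun.
Proof.
  split.
  - intros x y; apply minus_zero_eq, norm_small; intros e.
    assert (He : 0 < e / 3) by (pose proof (cond_pos e); lra).
    set (d := mkposreal _ He).
    destruct (filter_ex _ (filter_and _ _ (bop_limfun_spec (plus x y) d)
       (filter_and _ _ (bop_limfun_spec x d) (bop_limfun_spec y d))))
      as [A [H1 [H2 H3]]]; simpl in *.
    rewrite bop_at_plus in H1.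
    eapply Rle_trans; [apply (distV (plus (A x) (A y)))|].
    apply Rle_trans with (e / 3 + (e / 3 + e / 3)); [|lra].
    apply Rplus_le_compat; [left; exact H1|].
    eapply Rle_trans; [apply dist_plusV|].
    apply Rplus_le_compat; left; [exact H2 | exact H3].
  - intros c x; apply minus_zero_eq, norm_small; intros e.
    pose proof (Cmod_ge_0 c) as Hc; pose proof (cond_pos e) as Hpe.
    assert (He : 0 < e / (Cmod c + 1)) by (apply Rdiv_lt_0_compat; lra).
    set (d := mkposreal _ He).
    destruct (filter_ex _ (filter_and _ _ (bop_limfun_spec (scal c x) d)
                (bop_limfun_spec x d))) as [A [H1 H2]]; simpl in *.
    rewrite bop_at_scal in H1.
    eapply Rle_trans; [apply (distV (scal c (A x)))|].
    apply Rle_trans with (e / (Cmod c + 1) + Cmod c * (e / (Cmod c + 1)));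
      [|right; field; lra].
    apply Rplus_le_compat; [left; exact H1|].
    eapply Rle_trans; [apply dist_scalV|].
    apply Rmult_le_compat_l; [exact Hc | left; exact H2].
  - destruct (bop_cauchy2 (mkposreal 1 Rlt_0_1)) as [A0 H0].
    pose proof (bop_limfun_dist H0) as HD; simpl in HD.
    destruct (linear_norm _ (bop_linear A0)) as [M [HM HA]].
    exists (1 + M); split; [lra|]; intros x.
    replace (bop_limfun x) with (plus (minus (bop_limfun x) (A0 x)) (A0 x)).
    + eapply Rle_trans; [apply normDV|].
      specialize (HD x); specialize (HA x); lra.
    + unfold minus; rewrite <- plus_assoc, plus_opp_l; apply plus_zero_r.
Qed.

Lemma bop_lim_ex : exists L : BoundedOp, forall e : posreal, F (ball L e).
Proof.
  exists (MkBoundedOp bop_limfun_linear); intros e.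
  assert (He : 0 < e / 3) by (pose proof (cond_pos e); lra).
  destruct (bop_cauchy2 (mkposreal _ He)) as [A0 H0].
  pose proof (bop_limfun_dist H0) as HD; simpl in HD.
  revert H0; apply filter_imp; intros A HA; simpl in HA.
  change (op_norm (minus A (MkBoundedOp bop_limfun_linear)) < e).
  apply Rle_lt_trans with (e / 3 + e / 3); [|pose proof (cond_pos e); lra].
  apply op_norm_le; [lra|]; intros x; rewrite bop_minus_apply; simpl.
  rewrite (minus_trans (A0 x)); eapply Rle_trans; [apply normDV|].
  rewrite <- (opp_minus (bop_limfun x)), normNV.
  specialize (HA x); specialize (HD x); lra.
Qed.

End Limit.

Definition bop_lim (F : (BoundedOp -> Prop) -> Prop) : BoundedOp :=
  epsilon (inhabits bop_zero) (fun L => forall e : posreal, F (ball L e)).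

Definition bop_CompleteSpace_mixin : CompleteSpace.mixin_of bop_UniformSpace.
Proof.
  apply (@CompleteSpace.Mixin bop_UniformSpace bop_lim).
  - intros F FF cF; unfold bop_lim.
    apply (epsilon_spec (inhabits bop_zero) (fun L => forall e : posreal, F (ball L e))).
    exact (bop_lim_ex FF cF).
  - intros F1 F2 H12 H21 e.
    replace F2 with F1; [apply ball_center|].
    apply functional_extensionality; intros Q; apply propositional_extensionality.
    split; [apply H21 | apply H12].
Defined.

Canonical bop_CompleteSpace :=
  CompleteSpace.Pack BoundedOp
    (CompleteSpace.Class BoundedOp bop_UniformSpace_mixin bop_CompleteSpace_mixin) BoundedOp.

Canonical bop_CompleteNormedModule :=
  CompleteNormedModule.Pack R_AbsRing BoundedOp
    (CompleteNormedModule.Class R_AbsRing BoundedOp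
       (NormedModule.class _ bop_NormedModule) bop_CompleteSpace_mixin) BoundedOp.

Definition is_inverse (A B : BoundedOp) : Prop :=
  bop_comp A B = bop_one /\ bop_comp B A = bop_one.

Definition bop_invertible (A : BoundedOp) : Prop := exists B, is_inverse A B.

(* A total function; the value is meaningful when [A] is invertible. *)
Definition bop_inv (A : BoundedOp) : BoundedOp := iota (is_inverse A).

End Operators.

Section Order.

Variable V : HilbertSpace.

Definition self_adjoint (A : BoundedOp V) : Prop :=
  forall u v : V, inner (A u) v = inner u (A v).

Definition nonneg_op (A : BoundedOp V) : Prop :=
  self_adjoint A /\ forall u : V, 0 <= Re (inner (A u) u).

Definition op_le (A B : BoundedOp V) : Prop := nonneg_op (minus B A).

Definition End_plus (A : BoundedOp V) : Prop := nonneg_op A /\ bop_invertible A.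

End Order.

Section Calculus.

Variable W : CompleteNormedModule R_AbsRing.

Definition ex_partials (f : C -> W) (z : C) : Prop :=
  ex_derive (fun t : R => f (t, Im z)) (Re z) /\
  ex_derive (fun t : R => f (Re z, t)) (Im z).

Definition dx (f : C -> W) (z : C) : W :=
  iota (is_derive (fun t : R => f (t, Im z)) (Re z)).

Definition dy (f : C -> W) (z : C) : W :=
  iota (is_derive (fun t : R => f (Re z, t)) (Im z)).

Fixpoint Ck_on (n : nat) (Omega : C -> Prop) (f : C -> W) : Prop :=
  (forall z : C, Omega z -> continuous f z) /\
  match n with
  | O => True
  | S m => (forall z : C, Omega z -> ex_partials f z) /\
           Ck_on m Omega (dx f) /\ Ck_on m Omega (dy f)
  end.

Definition smooth_on (Omega : C -> Prop) (f : C -> W) : Prop :=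
  forall n : nat, Ck_on n Omega f.

End Calculus.

Definition circle (a : C) (r t : R) : C := Cplus a (Cmult r (cos t, sin t)).

Definition closed_disc_in (Omega : C -> Prop) (a : C) (r : R) : Prop :=
  0 < r /\ forall z : C, Cmod (Cminus z a) <= r -> Omega z.

Section Curvature.

Variable V : HilbertSpace.

Definition d_z (P : C -> BoundedOp V) (z : C) : BoundedOp V :=
  bop_cscal (RtoC (1 / 2)) (minus (dx P z) (bop_cscal Ci (dy P z))).

Definition d_zbar (P : C -> BoundedOp V) (z : C) : BoundedOp V :=
  bop_cscal (RtoC (1 / 2)) (plus (dx P z) (bop_cscal Ci (dy P z))).

Definition seminegative_curvature (Omega : C -> Prop) (P : C -> BoundedOp V) : Prop :=
  forall z : C, Omega z ->
    op_le (minus (bop_comp (d_zbar P z) (bop_comp (bop_inv (P z)) (d_z P z)))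
                 (d_zbar (d_z P) z))
          zero.

(* With z = a + r e^{it}, 0 <= t <= 2 pi: |dz| = r dt, dz = i r e^{it} dt and
   d zbar = - i r e^{-it} dt. *)
Definition circle_int_arc (P : C -> BoundedOp V) (a : C) (r : R) : BoundedOp V :=
  RInt (fun t => scal r (P (circle a r t))) 0 (2 * PI).

Definition circle_int_dz (P : C -> BoundedOp V) (a : C) (r : R) : BoundedOp V :=
  RInt (fun t => bop_cscal (Cmult Ci (Cmult r (cos t, sin t))) (P (circle a r t)))
       0 (2 * PI).

Definition circle_int_dzbar (P : C -> BoundedOp V) (a : C) (r : R) : BoundedOp V :=
  RInt (fun t => bop_cscal (Cconj (Cmult Ci (Cmult r (cos t, sin t))))
                           (P (circle a r t)))
       0 (2 * PI).

Definition circle_schur (P : C -> BoundedOp V) (a : C) (r : R) : BoundedOp V :=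
  minus (circle_int_arc P a r)
        (bop_comp (circle_int_dz P a r)
           (bop_comp (bop_inv (circle_int_arc P a r)) (circle_int_dzbar P a r))).

End Curvature.

(* Main.v *)
(* For an affine map u(z) = u + (z - a) w put g(z) = <P(z) u(z), u(z)>.  Completing the square in
   w, the operator P_{z zbar} - P_{zbar} P^{-1} P_z is nonnegative exactly when the Laplacian of
   every such g is, that is when every g is subharmonic.  The same completion of the square gives
   <S u, u> = min over w of r * int_0^{2 pi} g(a + r e^{it}) dt for the left hand side S of the
   inequality; the mean value inequality and the monotonicity in r of the circular means of
   subharmonic functions then pass to S.  Conversely, the inequality for S at small radii gives the
   submean property of each g at a, hence the sign of its Laplacian there. *)

Require Import Defs.
From Stdlib Require Import Reals Lra ClassicalEpsilon.
From Coquelicot Require Import Coquelicot.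

Open Scope R_scope.

(** The analysis is scalar: operators enter it through the real entries [ip (P z u) v], with [ip]
    the real part of [inner]. Written in the coordinates of z - a, each g is a combination of
    finitely many entries with polynomial coefficients, so its Laplacian follows from formal rules
    for sums and products. The minimum formula needs the inverse of the arc integral of P. In
    infinite dimension a form that is strictly positive on nonzero vectors need not come from an
    invertible operator; a lower bound by a positive multiple of the squared norm is enough. Each
    P(z) has such a bound because it is invertible, and continuity carries it over a short arc.
    Attainment of the minimum gives the monotonicity: the minimiser for the larger radius is a
    competitor for the smaller one. In the converse, g(a) = <P(a) u, u> for every w, so one
    inequality at a bounds from below the means of the whole family, and the freedom in w recovers
    the full quadratic form in (u, w). *)

(** * Continuity in two real variables and differentiation under the integral sign *)

Lemma continuity_2d_pt_comp (f u v : R -> R -> R) (x y : R) :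
  continuity_2d_pt f (u x y) (v x y) ->
  continuity_2d_pt u x y -> continuity_2d_pt v x y ->
  continuity_2d_pt (fun s t => f (u s t) (v s t)) x y.
Proof.
  intros Hf Hu Hv; apply continuity_2d_pt_filterlim.
  apply continuity_2d_pt_filterlim in Hf.
  apply continuity_2d_pt_filterlim in Hu.
  apply continuity_2d_pt_filterlim in Hv.
  exact (continuous_comp_2 (fun z : R * R => u (fst z) (snd z))
           (fun z : R * R => v (fst z) (snd z)) f (x, y) Hu Hv Hf).
Qed.

Lemma continuity_2d_pt_snd (f : R -> R) (x y : R) :
  continuous f y -> continuity_2d_pt (fun _ t => f t) x y.
Proof.
  intros Hf; apply continuity_2d_pt_filterlim.
  apply (continuous_comp (fun z : R * R => snd z) f (x, y)); [apply continuous_snd | exact Hf].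
Qed.

Lemma continuity_2d_pt_slice (f : R -> R -> R) (x y : R) :
  continuity_2d_pt f x y -> continuous (f x) y.
Proof.
  intros Hf; apply continuity_2d_pt_filterlim in Hf.
  apply (continuous_comp_2 (fun _ : R => x) (fun t : R => t) f y);
    [apply continuous_const | apply continuous_id | exact Hf].
Qed.

(* Compactness of [a, b], read off the uniform continuity of the indicator function of [Q]. *)
Lemma tube_lemma (Q : R -> R -> Prop) (a b x : R) :
  (forall t, a <= t <= b -> locally_2d Q x t) ->
  locally x (fun s => forall t, a <= t <= b -> Q s t).
Proof.
  intros HQ.
  set (f := fun s t => if excluded_middle_informative (Q s t) then 1 else 0).
  assert (Hf : forall t, a <= t <= b -> continuity_2d_pt f x t).
  { intros t Ht; apply continuity_2d_pt_ext_loc with (fun _ _ => 1).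
    - apply locally_2d_impl with (2 := HQ t Ht); apply locally_2d_forall.
      intros u v HQuv; unfold f; destruct excluded_middle_informative; tauto.
    - apply continuity_2d_pt_const. }
  destruct (uniform_continuity_2d_1d' f a b x Hf (mkposreal 1 Rlt_0_1)) as [d Hd].
  exists d; intros s Hs t Ht.
  assert (Hsd : x - d <= s <= x + d).
  { change (Rabs (s - x) < d) in Hs; apply Rabs_def2 in Hs; lra. }
  pose proof (cond_pos d) as Hd0.
  assert (Hts : Rabs (t - t) < d) by (rewrite Rminus_diag, Rabs_R0; exact Hd0).
  specialize (Hd t x t s Ht ltac:(lra) Ht Hsd Hts); simpl in Hd; unfold f in Hd.
  destruct (excluded_middle_informative (Q s t)) as [H | H]; [exact H | exfalso].
  destruct (excluded_middle_informative (Q x t)) as [_ | H'].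
  - rewrite Rminus_0_l, Rabs_Ropp, Rabs_R1 in Hd; lra.
  - apply H', locally_2d_singleton, HQ, Ht.
Qed.

(** [is_derive_RInt_param] asks for one neighbourhood of [x] that serves all [t]. The hypotheses
    here are local at each point of the segment; [tube_lemma] makes them uniform. *)
Lemma is_derive_RInt_param_continuous (F dF : R -> R -> R) (a b x : R) :
  a <= b ->
  (forall t, a <= t <= b ->
    locally_2d (fun s t => is_derive (fun u => F u t) s (dF s t)) x t) ->
  (forall t, a <= t <= b -> locally_2d (continuity_2d_pt F) x t) ->
  (forall t, a <= t <= b -> continuity_2d_pt dF x t) ->
  is_derive (fun s => RInt (F s) a b) x (RInt (dF x) a b).
Proof.
  intros Hab HdF HF HcdF.
  assert (E : RInt (dF x) a b = RInt (fun t => Derive (fun u => F u t) x) a b).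
  { apply RInt_ext; intros t Ht; rewrite Rmin_left, Rmax_right in Ht by exact Hab.
    symmetry; apply is_derive_unique.
    exact (locally_2d_singleton _ _ _ (HdF t ltac:(lra))). }
  rewrite E; apply (is_derive_RInt_param F a b x); rewrite ?Rmin_left, ?Rmax_right by exact Hab.
  - apply filter_imp with (2 := tube_lemma _ a b x HdF); intros s Hs t Ht.
    eexists; exact (Hs t Ht).
  - intros t Ht; apply continuity_2d_pt_ext_loc with (2 := HcdF t Ht).
    apply locally_2d_impl with (2 := HdF t Ht); apply locally_2d_forall.
    intros u v H; symmetry; apply is_derive_unique, H.
  - apply filter_imp with (2 := tube_lemma _ a b x HF); intros s Hs.
    apply (ex_RInt_continuous (F s)); intros t Ht.
    rewrite Rmin_left, Rmax_right in Ht by exact Hab.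
    apply continuity_2d_pt_slice, Hs, Ht.
Qed.

(** * Functions of class C^2 of two real variables *)

(** The partial derivatives are explicit data instead of [Derive] terms, so that sums and products
    carry theirs as closed formulas. *)
Definition C1_on (Omega : C -> Prop) (f fx fy : R -> R -> R) : Prop :=
  forall x y, Omega (x, y) ->
    is_derive (fun s => f s y) x (fx x y) /\ is_derive (f x) y (fy x y) /\
    continuity_2d_pt fx x y /\ continuity_2d_pt fy x y.

Lemma open_locally_2d (Omega : C -> Prop) (x y : R) :
  open Omega -> Omega (x, y) -> locally_2d (fun u v => Omega (u, v)) x y.
Proof.
  intros HO Hz; apply locally_2d_locally.
  apply filter_imp with (2 := HO (x, y) Hz); intros [u v] H; exact H.
Qed.

Lemma C1_on_differentiable Omega f fx fy x y :
  open Omega -> C1_on Omega f fx fy -> Omega (x, y) ->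
  differentiable_pt_lim f x y (fx x y) (fy x y).
Proof.
  intros HO Hf Hz; pose proof (open_locally_2d Omega x y HO Hz) as HL.
  apply filterdiff_differentiable_pt_lim.
  apply is_derive_filterdiff.
  - apply (proj1 (locally_2d_locally _ x y)) in HL.
    apply filter_imp with (2 := HL); intros [u v] Huv; apply (Hf u v Huv).
  - apply (Hf x y Hz).
  - exact (proj1 (continuity_2d_pt_filterlim _ _ _) (proj1 (proj2 (proj2 (Hf x y Hz))))).
Qed.

Lemma C1_on_continuous Omega f fx fy x y :
  open Omega -> C1_on Omega f fx fy -> Omega (x, y) -> continuity_2d_pt f x y.
Proof.
  intros HO Hf Hz; apply differentiable_continuity_pt.
  exists (fx x y), (fy x y); eapply C1_on_differentiable; eassumption.
Qed.

Lemma C1_on_comp Omega f fx fy (u v : R -> R) t du dv :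
  open Omega -> C1_on Omega f fx fy -> Omega (u t, v t) ->
  is_derive u t du -> is_derive v t dv ->
  is_derive (fun t => f (u t) (v t)) t (fx (u t) (v t) * du + fy (u t) (v t) * dv).
Proof.
  intros HO Hf Hz Hu Hv; apply is_derive_Reals; apply is_derive_Reals in Hu, Hv.
  apply derivable_pt_lim_comp_2d; trivial; eapply C1_on_differentiable; eassumption.
Qed.

Lemma C1_on_plus Omega f fx fy g gx gy :
  C1_on Omega f fx fy -> C1_on Omega g gx gy ->
  C1_on Omega (fun x y => f x y + g x y) (fun x y => fx x y + gx x y)
    (fun x y => fy x y + gy x y).
Proof.
  intros Hf Hg x y Hz; destruct (Hf x y Hz) as (F1 & F2 & F3 & F4),
    (Hg x y Hz) as (G1 & G2 & G3 & G4).
  refine (conj _ (conj _ (conj _ _))).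
  - apply (is_derive_plus (fun s => f s y) (fun s => g s y) x); assumption.
  - apply (is_derive_plus (f x) (g x) y); assumption.
  - apply continuity_2d_pt_plus; assumption.
  - apply continuity_2d_pt_plus; assumption.
Qed.

Lemma C1_on_mult Omega f fx fy g gx gy :
  open Omega -> C1_on Omega f fx fy -> C1_on Omega g gx gy ->
  C1_on Omega (fun x y => f x y * g x y) (fun x y => fx x y * g x y + f x y * gx x y)
    (fun x y => fy x y * g x y + f x y * gy x y).
Proof.
  intros HO Hf Hg x y Hz.
  pose proof (C1_on_continuous Omega f fx fy x y HO Hf Hz) as Fc.
  pose proof (C1_on_continuous Omega g gx gy x y HO Hg Hz) as Gc.
  destruct (Hf x y Hz) as (F1 & F2 & F3 & F4), (Hg x y Hz) as (G1 & G2 & G3 & G4).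
  refine (conj _ (conj _ (conj _ _))).
  - exact (is_derive_mult (fun s => f s y) (fun s => g s y) x _ _ F1 G1 Rmult_comm).
  - exact (is_derive_mult (f x) (g x) y _ _ F2 G2 Rmult_comm).
  - apply continuity_2d_pt_plus; apply continuity_2d_pt_mult; assumption.
  - apply continuity_2d_pt_plus; apply continuity_2d_pt_mult; assumption.
Qed.

Lemma C1_on_const Omega c : C1_on Omega (fun _ _ => c) (fun _ _ => 0) (fun _ _ => 0).
Proof.
  intros x y _; refine (conj _ (conj _ (conj _ _))); try apply continuity_2d_pt_const;
    auto_derive; trivial; ring.
Qed.

(** A function with formal derivatives up to order two, so that a Laplacian is found by computation.
    By [C2_on], [jxy] is the y-derivative of [jx] and [jyx] the x-derivative of [jy]; their equality
    is not built in. *)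
Record jet2 := Jet2 { j0 : R -> R -> R; jx : R -> R -> R; jy : R -> R -> R;
  jxx : R -> R -> R; jxy : R -> R -> R; jyx : R -> R -> R; jyy : R -> R -> R }.

Definition C2_on (Omega : C -> Prop) (j : jet2) : Prop :=
  C1_on Omega (j0 j) (jx j) (jy j) /\ C1_on Omega (jx j) (jxx j) (jxy j) /\
  C1_on Omega (jy j) (jyx j) (jyy j).

Definition lap (j : jet2) (x y : R) : R := jxx j x y + jyy j x y.

Definition jet_const (c : R) : jet2 :=
  Jet2 (fun _ _ => c) (fun _ _ => 0) (fun _ _ => 0) (fun _ _ => 0) (fun _ _ => 0)
    (fun _ _ => 0) (fun _ _ => 0).

Definition jet_fst (a : R) : jet2 :=
  Jet2 (fun x _ => x - a) (fun _ _ => 1) (fun _ _ => 0) (fun _ _ => 0) (fun _ _ => 0)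
    (fun _ _ => 0) (fun _ _ => 0).

Definition jet_snd (a : R) : jet2 :=
  Jet2 (fun _ y => y - a) (fun _ _ => 0) (fun _ _ => 1) (fun _ _ => 0) (fun _ _ => 0)
    (fun _ _ => 0) (fun _ _ => 0).

Definition jet_plus (j k : jet2) : jet2 :=
  Jet2 (fun x y => j0 j x y + j0 k x y) (fun x y => jx j x y + jx k x y)
    (fun x y => jy j x y + jy k x y) (fun x y => jxx j x y + jxx k x y)
    (fun x y => jxy j x y + jxy k x y) (fun x y => jyx j x y + jyx k x y)
    (fun x y => jyy j x y + jyy k x y).

(** The second-order terms are left uncollected, in the shape produced by [C1_on_plus] and
    [C1_on_mult], so that [C2_on_mult] holds by unification. *)
Definition jet_mult (j k : jet2) : jet2 :=
  Jet2 (fun x y => j0 j x y * j0 k x y)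
    (fun x y => jx j x y * j0 k x y + j0 j x y * jx k x y)
    (fun x y => jy j x y * j0 k x y + j0 j x y * jy k x y)
    (fun x y => (jxx j x y * j0 k x y + jx j x y * jx k x y) +
                (jx j x y * jx k x y + j0 j x y * jxx k x y))
    (fun x y => (jxy j x y * j0 k x y + jx j x y * jy k x y) +
                (jy j x y * jx k x y + j0 j x y * jxy k x y))
    (fun x y => (jyx j x y * j0 k x y + jy j x y * jx k x y) +
                (jx j x y * jy k x y + j0 j x y * jyx k x y))
    (fun x y => (jyy j x y * j0 k x y + jy j x y * jy k x y) +
                (jy j x y * jy k x y + j0 j x y * jyy k x y)).

Lemma C2_on_const Omega c : C2_on Omega (jet_const c).
Proof. split; [exact (C1_on_const Omega c) | split; exact (C1_on_const Omega 0)]. Qed.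

Lemma C2_on_fst Omega a : C2_on Omega (jet_fst a).
Proof.
  split; [|split; [exact (C1_on_const Omega 1)|exact (C1_on_const Omega 0)]].
  intros x y _; simpl; refine (conj _ (conj _ (conj _ _))); try apply continuity_2d_pt_const;
    auto_derive; trivial; ring.
Qed.

Lemma C2_on_snd Omega a : C2_on Omega (jet_snd a).
Proof.
  split; [|split; [exact (C1_on_const Omega 0)|exact (C1_on_const Omega 1)]].
  intros x y _; simpl; refine (conj _ (conj _ (conj _ _))); try apply continuity_2d_pt_const;
    auto_derive; trivial; ring.
Qed.

Lemma C2_on_plus Omega j k : C2_on Omega j -> C2_on Omega k -> C2_on Omega (jet_plus j k).
Proof.
  intros (J1 & J2 & J3) (K1 & K2 & K3); split; [|split]; apply C1_on_plus; assumption.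
Qed.

Lemma C2_on_mult Omega j k :
  open Omega -> C2_on Omega j -> C2_on Omega k -> C2_on Omega (jet_mult j k).
Proof.
  intros HO (J1 & J2 & J3) (K1 & K2 & K3); split; [|split].
  - apply C1_on_mult; assumption.
  - apply C1_on_plus; apply C1_on_mult; assumption.
  - apply C1_on_plus; apply C1_on_mult; assumption.
Qed.

(** * Circular means *)

Lemma circle_coord (a : C) (r t : R) : circle a r t = (fst a + r * cos t, snd a + r * sin t).
Proof. apply injective_projections; simpl; ring. Qed.

Lemma Cmod_circle (a : C) (r t : R) : 0 <= r -> Cmod (Cminus (circle a r t) a) = r.
Proof.
  intros Hr; rewrite circle_coord; unfold Cmod; simpl.
  replace (_ + _) with (Rsqr r).
  - apply sqrt_Rsqr, Hr.
  - pose proof (sin2_cos2 t) as E; unfold Rsqr in *.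
    transitivity (r * r * (sin t * sin t + cos t * cos t)); [rewrite E; ring | ring].
Qed.

Definition polar (f : R -> R -> R) (a : C) (r t : R) : R :=
  f (fst a + r * cos t) (snd a + r * sin t).

(** Not normalised: this is 2 pi times the mean value. *)
Definition circle_mean (f : R -> R -> R) (a : C) (r : R) : R := RInt (polar f a r) 0 (2 * PI).

Lemma continuous_cos_R t : continuous cos t.
Proof. apply (ex_derive_continuous (V := R_NormedModule)); auto_derive; trivial. Qed.

Lemma continuous_sin_R t : continuous sin t.
Proof. apply (ex_derive_continuous (V := R_NormedModule)); auto_derive; trivial. Qed.

Lemma continuity_2d_polar f a r t :
  continuity_2d_pt f (fst a + r * cos t) (snd a + r * sin t) ->
  continuity_2d_pt (polar f a) r t.
Proof.
  intros Hf.
  apply (continuity_2d_pt_comp f (fun r t => fst a + r * cos t) (fun r t => snd a + r * sin t));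
    trivial; apply continuity_2d_pt_plus; try apply continuity_2d_pt_const;
    apply continuity_2d_pt_mult; try apply continuity_2d_pt_id1;
    apply continuity_2d_pt_snd; [apply continuous_cos_R | apply continuous_sin_R].
Qed.

Section CircularMean.

Variables (Omega : C -> Prop) (a : C).
Hypothesis HO : open Omega.

Let on_circle (r t : R) : Prop := Omega (fst a + r * cos t, snd a + r * sin t).

Lemma on_circle_locally r t : on_circle r t -> locally_2d on_circle r t.
Proof.
  intros H; pose proof (open_locally_2d Omega _ _ HO H) as HL.
  (* The indicator of [Omega] turns openness into continuity of a real function, which composes with
     the polar map. *)
  set (chi := fun u v => if excluded_middle_informative (Omega (u, v)) then 1 else 0).
  assert (Hchi : continuity_2d_pt chi (fst a + r * cos t) (snd a + r * sin t)).
  { apply continuity_2d_pt_ext_loc with (fun _ _ => 1); [|apply continuity_2d_pt_const].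
    apply locally_2d_impl with (2 := HL); apply locally_2d_forall.
    intros u v Huv; unfold chi; destruct excluded_middle_informative; tauto. }
  apply continuity_2d_polar, continuity_2d_pt_neq_0 in Hchi.
  - apply locally_2d_impl with (2 := Hchi); apply locally_2d_forall.
    intros u v Huv; unfold polar, chi in Huv.
    destruct excluded_middle_informative as [K | K]; [exact K | lra].
  - unfold polar, chi; destruct excluded_middle_informative as [K | K]; [lra | contradiction].
Qed.

Lemma is_derive_polar_r f fx fy r t :
  C1_on Omega f fx fy -> on_circle r t ->
  is_derive (fun s => polar f a s t) r
    (polar fx a r t * cos t + polar fy a r t * sin t).
Proof.
  intros Hf H.
  apply (C1_on_comp Omega f fx fy (fun s => fst a + s * cos t) (fun s => snd a + s * sin t));
    trivial; auto_derive; trivial; ring.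
Qed.

Lemma is_derive_polar_t f fx fy r t :
  C1_on Omega f fx fy -> on_circle r t ->
  is_derive (polar f a r) t
    (polar fx a r t * (- r * sin t) + polar fy a r t * (r * cos t)).
Proof.
  intros Hf H.
  apply (C1_on_comp Omega f fx fy (fun t => fst a + r * cos t) (fun t => snd a + r * sin t));
    trivial; auto_derive; trivial; ring.
Qed.

Lemma continuity_polar f fx fy r t :
  C1_on Omega f fx fy -> on_circle r t -> continuity_2d_pt (polar f a) r t.
Proof.
  intros Hf H; apply continuity_2d_polar.
  exact (C1_on_continuous Omega f fx fy _ _ HO Hf H).
Qed.

Lemma is_derive_circle_mean f fx fy r :
  C1_on Omega f fx fy -> (forall t, on_circle r t) ->
  is_derive (circle_mean f a) r
    (RInt (fun t => polar fx a r t * cos t + polar fy a r t * sin t) 0 (2 * PI)).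
Proof.
  intros Hf Hr; pose proof PI_RGT_0.
  apply (is_derive_RInt_param_continuous (polar f a)
           (fun r t => polar fx a r t * cos t + polar fy a r t * sin t)); [lra | | |];
    intros t _.
  - apply locally_2d_impl with (2 := on_circle_locally r t (Hr t)); apply locally_2d_forall.
    intros u v Huv; apply is_derive_polar_r; assumption.
  - apply locally_2d_impl with (2 := on_circle_locally r t (Hr t)); apply locally_2d_forall.
    intros u v Huv; eapply continuity_polar; eassumption.
  - apply continuity_2d_pt_plus; apply continuity_2d_pt_mult;
      try apply continuity_2d_polar, (Hf _ _ (Hr t));
      apply continuity_2d_pt_snd; [apply continuous_cos_R | apply continuous_sin_R].
Qed.

Variable j : jet2.
Hypothesis Hj : C2_on Omega j.

(** [H] and [K] are the first and second radial derivatives of [j0 j] in polar coordinates around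
    [a]. *)
Let H (r t : R) : R := polar (jx j) a r t * cos t + polar (jy j) a r t * sin t.
Let K (r t : R) : R :=
  (polar (jxx j) a r t * cos t + polar (jxy j) a r t * sin t) * cos t +
  (polar (jyx j) a r t * cos t + polar (jyy j) a r t * sin t) * sin t.

Lemma continuity_2d_H r t : on_circle r t -> continuity_2d_pt H r t.
Proof.
  intros Hr; destruct Hj as (_ & J2 & J3).
  apply continuity_2d_pt_plus; apply continuity_2d_pt_mult;
    try (eapply continuity_polar; eassumption);
    apply continuity_2d_pt_snd; [apply continuous_cos_R | apply continuous_sin_R].
Qed.

Lemma continuity_2d_K r t : on_circle r t -> continuity_2d_pt K r t.
Proof.
  intros Hr; destruct Hj as (_ & J2 & J3).
  pose proof (continuity_2d_pt_snd cos r t (continuous_cos_R t)).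
  pose proof (continuity_2d_pt_snd sin r t (continuous_sin_R t)).
  apply continuity_2d_pt_plus; apply continuity_2d_pt_mult; try assumption;
    apply continuity_2d_pt_plus; apply continuity_2d_pt_mult; try assumption;
    apply continuity_2d_polar; first [apply (J2 _ _ Hr) | apply (J3 _ _ Hr)].
Qed.

Lemma is_derive_mean_H r :
  (forall t, on_circle r t) ->
  is_derive (fun r => RInt (H r) 0 (2 * PI)) r (RInt (K r) 0 (2 * PI)).
Proof.
  intros Hr; pose proof PI_RGT_0; destruct Hj as (_ & J2 & J3).
  apply (is_derive_RInt_param_continuous H K); [lra | | |]; intros t _.
  - apply locally_2d_impl with (2 := on_circle_locally r t (Hr t)); apply locally_2d_forall.
    intros u v Huv.
    pose proof (is_derive_polar_r _ _ _ u v J2 Huv) as D2.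
    pose proof (is_derive_polar_r _ _ _ u v J3 Huv) as D3.
    unfold H, K; apply (is_derive_plus (K := R_AbsRing) (V := R_NormedModule)
      (fun r => polar (jx j) a r v * cos v) (fun r => polar (jy j) a r v * sin v)).
    + evar_last; [apply (is_derive_scal_l _ _ _ (cos v) D2) | reflexivity].
    + evar_last; [apply (is_derive_scal_l _ _ _ (sin v) D3) | reflexivity].
  - apply locally_2d_impl with (2 := on_circle_locally r t (Hr t)); apply locally_2d_forall.
    intros u v Huv; apply continuity_2d_H, Huv.
  - apply continuity_2d_K, Hr.
Qed.

(* In polar coordinates [r^2 Delta = r d_r (r d_r) + d_t^2], and the last term integrates to
   zero over a period. *)
Lemma mean_laplacian r :
  (forall t, on_circle r t) ->
  r * (RInt (H r) 0 (2 * PI) + r * RInt (K r) 0 (2 * PI)) =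
  r ^ 2 * RInt (polar (lap j) a r) 0 (2 * PI).
Proof.
  intros Hr; destruct Hj as (_ & J2 & J3).
  (* [G] is the angular derivative of [j0 j], and [dG] is the second angular derivative as the polar
     form of the Laplacian predicts it. *)
  set (G := fun t => r * (- (polar (jx j) a r t) * sin t + polar (jy j) a r t * cos t)).
  set (dG := fun t => r ^ 2 * polar (lap j) a r t - r * (H r t + r * K r t)).
  assert (Clap : forall t, continuous (polar (lap j) a r) t).
  { intros t; apply continuity_2d_pt_slice, continuity_2d_polar.
    apply continuity_2d_pt_plus; [apply (J2 _ _ (Hr t)) | apply (J3 _ _ (Hr t))]. }
  assert (CH : forall t, continuous (H r) t)
    by (intros t; apply continuity_2d_pt_slice, continuity_2d_H, Hr).
  assert (CK : forall t, continuous (K r) t)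
    by (intros t; apply continuity_2d_pt_slice, continuity_2d_K, Hr).
  assert (IH := RInt_correct _ _ _ (ex_RInt_continuous (H r) 0 (2 * PI) (fun t _ => CH t))).
  assert (IK := RInt_correct _ _ _ (ex_RInt_continuous (K r) 0 (2 * PI) (fun t _ => CK t))).
  assert (IL := RInt_correct _ _ _
    (ex_RInt_continuous (polar (lap j) a r) 0 (2 * PI) (fun t _ => Clap t))).
  assert (I1 : is_RInt dG 0 (2 * PI) (minus (G (2 * PI)) (G 0))).
  { apply (is_RInt_derive G dG); intros t _.
    - pose proof (is_derive_polar_t _ _ _ r t J2 (Hr t)) as D2.
      pose proof (is_derive_polar_t _ _ _ r t J3 (Hr t)) as D3.
      unfold G; evar_last.
      + apply is_derive_scal.
        apply (is_derive_plus (K := R_AbsRing) (V := R_NormedModule)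
          (fun t => - polar (jx j) a r t * sin t) (fun t => polar (jy j) a r t * cos t)).
        * apply (is_derive_mult (K := R_AbsRing) (fun t => - polar (jx j) a r t) sin).
          -- apply (is_derive_opp (K := R_AbsRing) (V := R_NormedModule)), D2.
          -- apply is_derive_Reals, derivable_pt_lim_sin.
          -- exact Rmult_comm.
        * apply (is_derive_mult (K := R_AbsRing) (fun t => polar (jy j) a r t) cos).
          -- exact D3.
          -- apply is_derive_Reals, derivable_pt_lim_cos.
          -- exact Rmult_comm.
      + unfold dG, H, K, lap, polar; simpl.
        pose proof (sin2_cos2 t) as E; unfold Rsqr in E.
        set (c := cos t) in *; set (s := sin t) in *.
        unfold plus, mult, opp; simpl.
        set (X := fst a + r * c); set (Y := snd a + r * s).
        (* Inserting sin^2 + cos^2 = 1 by hand makes the rest a polynomial identity in independent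
           [c] and [s]. *)
        replace (r * (r * 1) * (jxx j X Y + jyy j X Y)) with
          (r * (r * 1) * (jxx j X Y + jyy j X Y) * (s * s + c * c)) by (rewrite E; ring).
        ring.
    - unfold dG.
      apply (continuous_minus (V := R_NormedModule)).
      + apply (continuous_scal_r (V := R_NormedModule)), Clap.
      + apply (continuous_scal_r (V := R_NormedModule)).
        apply (continuous_plus (V := R_NormedModule)); [apply CH|].
        apply (continuous_scal_r (V := R_NormedModule)), CK. }
  assert (I2 : is_RInt dG 0 (2 * PI) (r ^ 2 * RInt (polar (lap j) a r) 0 (2 * PI) -
    r * (RInt (H r) 0 (2 * PI) + r * RInt (K r) 0 (2 * PI)))).
  { apply (is_RInt_minus (V := R_NormedModule)).
    - apply (is_RInt_scal (V := R_NormedModule)), IL.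
    - apply (is_RInt_scal (V := R_NormedModule)).
      apply (is_RInt_plus (V := R_NormedModule)); [exact IH|].
      apply (is_RInt_scal (V := R_NormedModule)), IK. }
  apply (is_RInt_unique (V := R_CompleteNormedModule)) in I1, I2.
  (* By periodicity the integral of [dG] is zero. *)
  assert (E : G (2 * PI) = G 0).
  { unfold G, polar; rewrite cos_2PI, sin_2PI, cos_0, sin_0; reflexivity. }
  rewrite I1, E in I2; unfold minus, plus, opp in I2; simpl in I2.
  lra.
Qed.

(** Let M be the circular mean as a function of the radius. By [mean_laplacian], q M'(q) has
    derivative q times the integral of the Laplacian, hence nonnegative; as it vanishes at q = 0, M'
    is nonnegative. *)
Lemma circle_mean_incr r s :
  0 <= r <= s ->
  (forall q t, 0 <= q <= s -> on_circle q t) ->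
  (forall q t, 0 <= q <= s -> 0 <= polar (lap j) a q t) ->
  circle_mean (j0 j) a r <= circle_mean (j0 j) a s.
Proof.
  intros Hrs Hs Hlap; pose proof PI_RGT_0.
  assert (Hdm : forall q, 0 < q <= s -> 0 <= RInt (H q) 0 (2 * PI)).
  { intros q Hq.
    (* Mean value theorem on [0, q] for q M'(q), whose value at 0 is zero. *)
    destruct (MVT_cor2 (fun q => q * RInt (H q) 0 (2 * PI))
        (fun q => RInt (H q) 0 (2 * PI) + q * RInt (K q) 0 (2 * PI)) 0 q) as (c & Ec & Hc);
        [lra | |].
      + intros c Hc; apply is_derive_Reals.
        evar_last; [apply (is_derive_mult (K := R_AbsRing) (fun q => q)
          (fun q => RInt (H q) 0 (2 * PI))) |].
        * apply is_derive_id.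
        * apply is_derive_mean_H; intros t; apply Hs; lra.
        * exact Rmult_comm.
        * unfold plus, mult, one; simpl; ring.
      + assert (E := mean_laplacian c (fun t => Hs c t ltac:(lra))).
        assert (L : 0 <= RInt (polar (lap j) a c) 0 (2 * PI)).
        { apply RInt_ge_0; [lra | |].
          - apply (ex_RInt_continuous (polar (lap j) a c)); intros t _.
            assert (Hct : on_circle c t) by (apply Hs; lra).
            apply continuity_2d_pt_slice, continuity_2d_polar; destruct Hj as (_ & J2 & J3).
            apply continuity_2d_pt_plus; [apply (J2 _ _ Hct) | apply (J3 _ _ Hct)].
          - intros t _; apply Hlap; lra. }
        set (A := RInt (H c) 0 (2 * PI) + c * RInt (K c) 0 (2 * PI)) in *.
        (* [E] reads c A = c^2 times a nonnegative integral, and c > 0. *)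
        assert (HA : 0 <= A) by nra.
        assert (q * RInt (H q) 0 (2 * PI) = q * A) by lra.
        nra. }
  destruct (Req_dec r s) as [-> | Hne]; [apply Rle_refl|].
  destruct (MVT_cor2 (circle_mean (j0 j) a) (fun q => RInt (H q) 0 (2 * PI)) r s)
    as (c & Ec & Hc); [lra | |].
  - intros c Hc; apply is_derive_Reals.
    apply (is_derive_circle_mean (j0 j) (jx j) (jy j)); [apply Hj | intros t; apply Hs; lra].
  - specialize (Hdm c ltac:(lra)); nra.
Qed.

End CircularMean.

Lemma circle_in_disc (Omega : C -> Prop) (a : C) (r s t : R) :
  closed_disc_in Omega a s -> 0 <= r <= s -> Omega (circle a r t).
Proof. intros [_ H] Hr; apply H; rewrite Cmod_circle; apply Hr. Qed.

Lemma subharmonic_mean_incr (Omega : C -> Prop) (a : C) (j : jet2) (r s : R) :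
  open Omega -> C2_on Omega j -> closed_disc_in Omega a s -> 0 <= r <= s ->
  (forall x y, Omega (x, y) -> 0 <= lap j x y) ->
  circle_mean (j0 j) a r <= circle_mean (j0 j) a s.
Proof.
  intros HO Hj Hs Hr Hlap.
  assert (D : forall q t, 0 <= q <= s -> Omega (fst a + q * cos t, snd a + q * sin t)).
  { intros q t Hq; rewrite <- circle_coord; exact (circle_in_disc _ _ _ _ t Hs Hq). }
  apply (circle_mean_incr Omega a HO j Hj r s Hr D).
  intros q t Hq; apply Hlap, D, Hq.
Qed.

Lemma circle_mean_0 (f : R -> R -> R) (a : C) : circle_mean f a 0 = 2 * PI * f (fst a) (snd a).
Proof.
  unfold circle_mean, polar.
  rewrite (RInt_ext _ (fun _ => f (fst a) (snd a))).
  - rewrite RInt_const; unfold scal; simpl; unfold mult; simpl; ring.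
  - intros t _; f_equal; ring.
Qed.

(** * From the submean inequality at a point to the sign of the Laplacian there *)

(** A square instead of a disc, to match the neighbourhoods of [locally_2d]. *)
Lemma open_square (a : C) (d : R) :
  open (fun z : C => Rabs (fst z - fst a) < d /\ Rabs (snd z - snd a) < d).
Proof.
  intros z [H1 H2].
  assert (He : 0 < Rmin (d - Rabs (fst z - fst a)) (d - Rabs (snd z - snd a)))
    by (apply Rmin_pos; lra).
  exists (mkposreal _ He); intros w [K1 K2].
  change (Rabs (fst w - fst z) < Rmin (d - Rabs (fst z - fst a)) (d - Rabs (snd z - snd a))) in K1.
  change (Rabs (snd w - snd z) < Rmin (d - Rabs (fst z - fst a)) (d - Rabs (snd z - snd a))) in K2.
  pose proof (Rmin_l (d - Rabs (fst z - fst a)) (d - Rabs (snd z - snd a))).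
  pose proof (Rmin_r (d - Rabs (fst z - fst a)) (d - Rabs (snd z - snd a))).
  pose proof (Rabs_triang (fst w - fst z) (fst z - fst a)) as T1.
  pose proof (Rabs_triang (snd w - snd z) (snd z - snd a)) as T2.
  replace (fst w - fst z + (fst z - fst a)) with (fst w - fst a) in T1 by ring.
  replace (snd w - snd z + (snd z - snd a)) with (snd w - snd a) in T2 by ring.
  split; lra.
Qed.

Lemma C2_on_subset (Omega Omega' : C -> Prop) (j : jet2) :
  (forall z, Omega' z -> Omega z) -> C2_on Omega j -> C2_on Omega' j.
Proof.
  intros HS (J1 & J2 & J3); split; [|split]; intros x y Hz;
    [apply J1 | apply J2 | apply J3]; apply HS, Hz.
Qed.

(* If [lap j = - d < 0] at [a], then [- j - d / 8 |z - a|^2] is subharmonic near [a], so the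
   circular means of [j] are strictly below its central value. *)
Lemma mean_property_lap_ge0 (Omega : C -> Prop) (a : C) (j : jet2) :
  open Omega -> C2_on Omega j -> Omega a ->
  (forall r, closed_disc_in Omega a r ->
    2 * PI * j0 j (fst a) (snd a) <= circle_mean (j0 j) a r) ->
  0 <= lap j (fst a) (snd a).
Proof.
  intros HO Hj Ha Hmean; pose proof PI_RGT_0.
  apply Rnot_lt_le; intros Hneg.
  set (d := - lap j (fst a) (snd a)); assert (Hd : 0 < d) by (unfold d; lra).
  rewrite (surjective_pairing a) in Ha.
  assert (Clap : continuity_2d_pt (lap j) (fst a) (snd a)).
  { destruct Hj as (_ & J2 & J3).
    apply continuity_2d_pt_plus; [apply (J2 _ _ Ha) | apply (J3 _ _ Ha)]. }
  assert (Hd2 : 0 < d / 2) by lra.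
  (* The tolerance d / 2 keeps - [lap j] above d / 2 on the square. *)
  destruct (locally_2d_and _ _ _ _ (Clap (mkposreal _ Hd2))
    (open_locally_2d Omega _ _ HO Ha)) as [e He]; simpl in He.
  pose proof (cond_pos e) as Hepos.
  set (S := fun z : C => Rabs (fst z - fst a) < e /\ Rabs (snd z - snd a) < e).
  (* The Laplacian of |z - a|^2 is 4, so the coefficient d / 8 uses up exactly the margin d / 2. *)
  set (h := jet_plus (jet_mult (jet_const (-1)) j)
    (jet_mult (jet_const (- d / 8))
      (jet_plus (jet_mult (jet_fst (fst a)) (jet_fst (fst a)))
                (jet_mult (jet_snd (snd a)) (jet_snd (snd a)))))).
  assert (HS : open S) by apply open_square.
  assert (HSO : forall z, S z -> Omega z).
  { intros [u v] [H1 H2]; apply (He u v H1 H2). }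
  assert (Hh : C2_on S h).
  { pose proof (C2_on_fst S (fst a)) as H1; pose proof (C2_on_snd S (snd a)) as H2.
    exact (C2_on_plus S _ _
      (C2_on_mult S _ _ HS (C2_on_const S (-1)) (C2_on_subset _ _ _ HSO Hj))
      (C2_on_mult S _ _ HS (C2_on_const S (- d / 8))
        (C2_on_plus S _ _ (C2_on_mult S _ _ HS H1 H1) (C2_on_mult S _ _ HS H2 H2)))). }
  assert (Hdisc : closed_disc_in S a (e / 2)).
  { split; [lra|]; intros z Hz.
    pose proof (Rmax_Cmod (Cminus z a)) as Hm; unfold S.
    pose proof (Rmax_l (Rabs (fst (Cminus z a))) (Rabs (snd (Cminus z a)))).
    pose proof (Rmax_r (Rabs (fst (Cminus z a))) (Rabs (snd (Cminus z a)))).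
    simpl in *; unfold Rminus; split; lra. }
  assert (Hlap : forall x y, S (x, y) -> 0 <= lap h x y).
  { intros x y [H1 H2]; destruct (He x y H1 H2) as [H3 _]; apply Rabs_def2 in H3.
    assert (El : lap h x y = - lap j x y - d / 2) by (unfold lap, h; simpl; field).
    rewrite El; unfold d in *; lra. }
  assert (Hle := subharmonic_mean_incr S a h 0 (e / 2) HS Hh Hdisc ltac:(lra) Hlap).
  rewrite circle_mean_0 in Hle.
  assert (HdiscO : closed_disc_in Omega a (e / 2)).
  { split; [lra|]; intros z Hz; apply HSO, Hdisc, Hz. }
  specialize (Hmean _ HdiscO).
  (* On this circle |z - a|^2 has the constant value (e / 2)^2, so the correction integrates
     explicitly to a strictly positive amount. *)
  assert (E : circle_mean (j0 h) a (e / 2) =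
    - circle_mean (j0 j) a (e / 2) - 2 * PI * (d / 8 * (e / 2) ^ 2)).
  { assert (I : is_RInt (polar (j0 j) a (e / 2)) 0 (2 * PI) (circle_mean (j0 j) a (e / 2))).
    { apply (RInt_correct (V := R_CompleteNormedModule)),
        (ex_RInt_continuous (V := R_CompleteNormedModule)); intros t _.
      apply continuity_2d_pt_slice.
      assert (Hz : Omega (circle a (e / 2) t)) by (eapply circle_in_disc; [exact HdiscO | lra]).
      rewrite circle_coord in Hz.
      exact (continuity_polar Omega a HO _ _ _ (e / 2) t (proj1 Hj) Hz). }
    apply (is_RInt_unique (V := R_CompleteNormedModule)).
    pose proof (is_RInt_const (V := R_NormedModule) 0 (2 * PI) (d / 8 * (e / 2) ^ 2)) as I2.
    pose proof (is_RInt_minus _ _ _ _ _ _ (is_RInt_opp _ _ _ _ I) I2) as I3.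
    evar_last; [eapply is_RInt_ext; [|exact I3] |].
    - intros t _; unfold polar, h, minus, plus, opp; simpl.
      pose proof (sin2_cos2 t) as E; unfold Rsqr in E.
      set (c := cos t) in *; set (s := sin t) in *; set (X := j0 j _ _).
      replace (d / 8 * (e / 2 * (e / 2 * 1))) with
        (d / 8 * (e / 2 * (e / 2 * 1)) * (s * s + c * c)) by (rewrite E; ring).
      field.
    - unfold minus, plus, opp, scal; simpl; unfold mult; simpl; ring. }
  rewrite E in Hle.
  assert (E0 : j0 h (fst a) (snd a) = - j0 j (fst a) (snd a)) by (unfold h; simpl; ring).
  rewrite E0 in Hle.
  assert (0 < 2 * PI * (d / 8 * (e / 2) ^ 2)).
  { apply Rmult_lt_0_compat; [lra|]; apply Rmult_lt_0_compat; [lra | apply pow_lt; lra]. }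
  lra.
Qed.

(** * The underlying real inner product *)

Section RealInner.

Variable V : HilbertSpace.

(** The real part loses nothing: by [Im_inner] the imaginary part of [inner u v] is [ip u] of i
    v. *)
Definition ip (u v : V) : R := Re (inner u v).

Lemma ip_plus_l u v w : ip (plus u v) w = ip u w + ip v w.
Proof. unfold ip; rewrite inner_plus_l; reflexivity. Qed.

Lemma ip_sym u v : ip u v = ip v u.
Proof. unfold ip; rewrite (inner_sym u v); reflexivity. Qed.

Lemma ip_plus_r u v w : ip u (plus v w) = ip u v + ip u w.
Proof. rewrite ip_sym, ip_plus_l, (ip_sym v), (ip_sym w); reflexivity. Qed.

Lemma ip_scal_real_l (r : R) (u v : V) : ip (scal (RtoC r : C_AbsRing) u) v = r * ip u v.
Proof. unfold ip; rewrite inner_scal_l; unfold Re; simpl; ring. Qed.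

Lemma ip_scal_real_r (r : R) (u v : V) : ip u (scal (RtoC r : C_AbsRing) v) = r * ip u v.
Proof. rewrite ip_sym, ip_scal_real_l, ip_sym; reflexivity. Qed.

Lemma ip_scal_conj (c : C) (u v : V) :
  ip (scal (c : C_AbsRing) u) v = ip u (scal (Cconj c : C_AbsRing) v).
Proof.
  rewrite (ip_sym u); unfold ip; rewrite !inner_scal_l, (inner_sym u v); unfold Re, Im; simpl; ring.
Qed.

Lemma opp_scal (u : V) : opp u = scal (RtoC (-1) : C_AbsRing) u.
Proof.
  transitivity (scal (opp one : C_AbsRing) u).
  { symmetry; apply (@scal_opp_one C_AbsRing V). }
  f_equal.
  apply injective_projections; simpl; ring.
Qed.

Lemma ip_opp_l (u v : V) : ip (opp u) v = - ip u v.
Proof. rewrite opp_scal, ip_scal_real_l; ring. Qed.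

Lemma ip_opp_r (u v : V) : ip u (opp v) = - ip u v.
Proof. rewrite ip_sym, ip_opp_l, ip_sym; reflexivity. Qed.

Lemma ip_zero_l (v : V) : ip zero v = 0.
Proof.
  pose proof (ip_plus_l zero zero v) as H; rewrite (@plus_zero_r V) in H; lra.
Qed.

Lemma ip_norm (u : V) : ip u u = norm u ^ 2.
Proof. unfold ip; rewrite inner_norm; reflexivity. Qed.

Lemma Im_inner (u v : V) : Im (inner u v) = ip u (scal (Ci : C_AbsRing) v).
Proof.
  rewrite ip_sym; unfold ip; rewrite inner_scal_l, (inner_sym u v); unfold Re, Im; simpl; ring.
Qed.

Lemma ip_ext (x y : V) : (forall v, ip x v = ip y v) -> x = y.
Proof.
  intros H; apply (@minus_zero_eq V), (@norm_eq0V V).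
  assert (E : norm (minus x y) ^ 2 = 0).
  { rewrite <- ip_norm; unfold minus at 1; rewrite ip_plus_l, ip_opp_l, H; ring. }
  destruct (Req_dec (norm (minus x y)) 0) as [H0 | H0]; [exact H0 | exfalso].
  apply (pow_nonzero _ 2) in H0; contradiction.
Qed.

(** A relation between two given operators, so no adjoint has to be constructed. For complex-linear
    operators the real identity implies the complex one ([adjoint_inner]). *)
Definition adjoint (A B : BoundedOp V) : Prop := forall u v, ip (A u) v = ip u (B v).

Lemma adjoint_inner (A B : BoundedOp V) :
  adjoint A B -> forall u v, inner (A u) v = inner u (B v).
Proof.
  intros H u v; apply injective_projections.
  - apply H.
  - change (Im (inner (A u) v) = Im (inner u (B v))).
    rewrite !Im_inner, H, (bop_at_scal B); reflexivity.
Qed.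

Lemma self_adjointP (A : BoundedOp V) : self_adjoint A <-> adjoint A A.
Proof.
  split; intros H; [|exact (adjoint_inner A A H)].
  intros u v; unfold ip; rewrite (H u v); reflexivity.
Qed.

Lemma nonneg_opP (A : BoundedOp V) :
  nonneg_op A <-> adjoint A A /\ forall u, 0 <= ip (A u) u.
Proof. unfold nonneg_op; rewrite self_adjointP; reflexivity. Qed.

Lemma adjoint_sym (A B : BoundedOp V) : adjoint A B -> adjoint B A.
Proof. intros H u v; rewrite ip_sym, <- H, ip_sym; reflexivity. Qed.

Lemma adjoint_plus (A B A' B' : BoundedOp V) :
  adjoint A A' -> adjoint B B' -> adjoint (plus A B) (plus A' B').
Proof.
  intros HA HB u v; change (ip (plus (A u) (B u)) v = ip u (plus (A' v) (B' v))).
  rewrite ip_plus_l, ip_plus_r, HA, HB; reflexivity.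
Qed.

Lemma adjoint_cscal (c : C) (A A' : BoundedOp V) :
  adjoint A A' -> adjoint (bop_cscal c A) (bop_cscal (Cconj c) A').
Proof.
  intros HA u v; change (ip (scal (c : C_AbsRing) (A u)) v =
    ip u (scal (Cconj c : C_AbsRing) (A' v))).
  rewrite ip_scal_conj, HA, (bop_at_scal A'); reflexivity.
Qed.

Lemma adjoint_opp (A A' : BoundedOp V) : adjoint A A' -> adjoint (opp A) (opp A').
Proof.
  intros HA u v; change (ip (opp (A u)) v = ip u (opp (A' v))).
  rewrite ip_opp_l, ip_opp_r, HA; reflexivity.
Qed.

Lemma adjoint_minus (A B A' B' : BoundedOp V) :
  adjoint A A' -> adjoint B B' -> adjoint (minus A B) (minus A' B').
Proof. intros HA HB; apply adjoint_plus; [exact HA | apply adjoint_opp, HB]. Qed.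

Lemma adjoint_scal (r : R) (A A' : BoundedOp V) :
  adjoint A A' -> adjoint (scal r A) (scal r A').
Proof.
  intros HA u v; change (ip (scal (RtoC r : C_AbsRing) (A u)) v =
    ip u (scal (RtoC r : C_AbsRing) (A' v))).
  rewrite ip_scal_real_l, ip_scal_real_r, HA; reflexivity.
Qed.

Lemma quadratic_discriminant (a b c : R) :
  (forall t, 0 <= a + 2 * t * b + t ^ 2 * c) -> b ^ 2 <= a * c.
Proof.
  intros H; destruct (Rtotal_order c 0) as [Hc | [Hc | Hc]].
  - exfalso; pose proof (H 0) as H0.
    (* For this [t], a + 2 |b| + c t = c < 0. Since t >= 1 and a >= 0, the quadratic is at most t c
       < 0. *)
    set (t := 1 + (a + 2 * Rabs b) / - c).
    assert (Ht : - c * t = - c + (a + 2 * Rabs b)) by (unfold t; field; lra).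
    pose proof (Rabs_pos b); pose proof (Rle_abs b) as Hb.
    assert (Hm : 1 <= t).
    { unfold t; assert (0 <= (a + 2 * Rabs b) / - c); [|lra].
      apply Rmult_le_pos; [lra | left; apply Rinv_0_lt_compat; lra]. }
    specialize (H t).
    assert (t * (a + 2 * Rabs b + c * t) < 0) by (apply Ropp_lt_cancel; nra).
    nra.
  - subst c; destruct (Req_dec b 0) as [-> | Hb]; [lra | exfalso].
    (* When c = 0 the expression is affine in t; here it takes the value -1. *)
    specialize (H (- (a + 1) / (2 * b))).
    replace (a + 2 * (- (a + 1) / (2 * b)) * b + (- (a + 1) / (2 * b)) ^ 2 * 0)
      with (- 1) in H by (field; exact Hb).
    lra.
  (* The minimiser of the quadratic. *)
  - specialize (H (- b / c)).
    replace (a + 2 * (- b / c) * b + (- b / c) ^ 2 * c) with ((a * c - b ^ 2) / c) in H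
      by (field; lra).
    apply (Rmult_le_compat_l c) in H; [|lra].
    replace (c * ((a * c - b ^ 2) / c)) with (a * c - b ^ 2) in H by (field; lra).
    lra.
Qed.

Lemma form_Cauchy_Schwarz (A : BoundedOp V) (u v : V) :
  adjoint A A -> (forall u, 0 <= ip (A u) u) ->
  ip (A u) v ^ 2 <= ip (A u) u * ip (A v) v.
Proof.
  intros HA Hpos; apply quadratic_discriminant; intros t.
  specialize (Hpos (plus u (scal (RtoC t : C_AbsRing) v))).
  rewrite bop_at_plus, bop_at_scal, !ip_plus_l, !ip_plus_r in Hpos.
  rewrite !ip_scal_real_l, !ip_scal_real_r in Hpos.
  rewrite (HA v u), (ip_sym v) in Hpos; nra.
Qed.

Lemma ip_bound (u v : V) : Rabs (ip u v) <= norm u * norm v.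
Proof.
  assert (H : ip u v ^ 2 <= norm u ^ 2 * norm v ^ 2).
  { rewrite <- !ip_norm; apply (form_Cauchy_Schwarz (bop_one V)).
    - intros x y; reflexivity.
    - intros x; simpl; rewrite ip_norm; apply pow2_ge_0. }
  pose proof (norm_ge_0 u); pose proof (norm_ge_0 v).
  rewrite <- (Rabs_pos_eq (norm u * norm v)) by nra.
  apply Rsqr_le_abs_0; unfold Rsqr; nra.
Qed.

(** * Inverses and coercivity *)

Definition coercive (A : BoundedOp V) (c : R) : Prop :=
  0 < c /\ forall u, c * norm u ^ 2 <= ip (A u) u.

(** [bop_inv] is a definite description, so uniqueness of the two-sided inverse has to be
    supplied. *)
Lemma is_inverse_inv (A : BoundedOp V) : bop_invertible A -> is_inverse A (bop_inv A).
Proof.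
  intros [B HB]; refine (iota_correct (V := bop_CompleteNormedModule V) (is_inverse A) _).
  exists B; split; [exact HB|]; intros B' HB'.
  apply bop_ext; intros x.
  destruct HB as [_ HB], HB' as [HB' _].
  assert (E1 : A (B' x) = x) by (change (bop_comp A B' x = x); rewrite HB'; reflexivity).
  rewrite <- E1 at 1; change (bop_comp B A (B' x) = B' x); rewrite HB; reflexivity.
Qed.

Lemma bop_inv_r (A : BoundedOp V) x : bop_invertible A -> A (bop_inv A x) = x.
Proof.
  intros H; change (bop_comp A (bop_inv A) x = x).
  rewrite (proj1 (is_inverse_inv A H)); reflexivity.
Qed.

Lemma bop_inv_l (A : BoundedOp V) x : bop_invertible A -> bop_inv A (A x) = x.
Proof.
  intros H; change (bop_comp (bop_inv A) A x = x).
  rewrite (proj2 (is_inverse_inv A H)); reflexivity.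
Qed.

Lemma adjoint_inv (A : BoundedOp V) :
  bop_invertible A -> adjoint A A -> adjoint (bop_inv A) (bop_inv A).
Proof.
  intros HI HA u v.
  rewrite <- (bop_inv_r A v HI) at 1; rewrite <- HA, bop_inv_r by exact HI; reflexivity.
Qed.

Lemma coercive_norm (A : BoundedOp V) c u : coercive A c -> c * norm u <= norm (A u).
Proof.
  intros [Hc HA]; specialize (HA u).
  pose proof (ip_bound (A u) u) as H; pose proof (Rle_abs (ip (A u) u)).
  pose proof (norm_ge_0 u) as Hu; pose proof (norm_ge_0 (A u)).
  destruct (Req_dec (norm u) 0) as [-> | Hne]; [lra|].
  apply Rmult_le_reg_r with (norm u); [lra | nra].
Qed.

Lemma coercive_inj (A : BoundedOp V) c x y : coercive A c -> A x = A y -> x = y.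
Proof.
  intros HA E; apply (@minus_zero_eq V), (@norm_eq0V V).
  pose proof (coercive_norm A c (minus x y) HA) as H.
  replace (A (minus x y)) with (zero : V) in H.
  - rewrite (@norm0V V) in H; destruct HA as [Hc _]; pose proof (norm_ge_0 (minus x y)); nra.
  - unfold minus; rewrite bop_at_plus, E, <- bop_at_plus, (@plus_opp_r V), bop_at_zero; reflexivity.
Qed.

Fixpoint bop_iter (T : BoundedOp V) (n : nat) (y : V) : V :=
  match n with O => y | S m => T (bop_iter T m y) end.

(* Neumann series. *)
Lemma contraction_solve (T : BoundedOp V) (q : R) (y : V) :
  0 <= q < 1 -> (forall x, norm (T x) <= q * norm x) -> exists x : V, minus x (T x) = y.
Proof.
  intros Hq HT; set (a := fun n => bop_iter T n y).
  assert (Ha : forall n, norm (a n) <= q ^ n * norm y).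
  { intros n; induction n as [|n IH]; simpl; [rewrite Rmult_1_l; apply Rle_refl|].
    eapply Rle_trans; [apply HT|]; fold (a n).
    rewrite Rmult_assoc; apply Rmult_le_compat_l; [lra | exact IH]. }
  assert (Hex : ex_series (K := C_AbsRing) (V := V) a).
  { apply ex_series_le with (fun n => q ^ n * norm y); [exact Ha|].
    apply ex_series_scal_r, ex_series_geom; rewrite Rabs_pos_eq; lra. }
  destruct Hex as [x Hx]; exists x.
  (* The shifted series converges both to x - y and, by continuity of [T], to T x. *)
  assert (H1 : is_series (K := C_AbsRing) (V := V) (fun n => a (S n)) (minus x y)).
  { apply is_series_incr_1; unfold minus; rewrite <- (@plus_assoc V).
    change (a O) with y; rewrite (@plus_opp_l V), (@plus_zero_r V); exact Hx. }
  assert (H2 : is_series (K := C_AbsRing) (V := V) (fun n => a (S n)) (T x)).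
  { unfold is_series in *; apply filterlim_ext with (fun n => T (sum_n a n)).
    - intros n; induction n as [|n IH]; [rewrite !sum_O; reflexivity|].
      rewrite !sum_Sn, bop_at_plus, IH; reflexivity.
    - eapply filterlim_comp; [exact Hx|].
      apply (linear_cont (K := C_AbsRing) T), bop_linear. }
  assert (E := filterlim_locally_unique (K := C_AbsRing) (V := V) _ _ _ H1 H2).
  apply (@plus_reg_r V (T x)); unfold minus.
  rewrite <- (@plus_assoc V), (@plus_opp_l V), (@plus_zero_r V).
  rewrite <- E; unfold minus.
  rewrite (@plus_comm V y), <- (@plus_assoc V), (@plus_opp_l V), (@plus_zero_r V); reflexivity.
Qed.

(** T = 1 - rho A is a contraction: |T x|^2 is at most (1 - 2 rho c + rho^2 M^2) |x|^2. The choice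
    rho = c / M^2 minimises this factor and gives k = 1 - c^2 / M^2. *)
Lemma coercive_surj (A : BoundedOp V) c y : coercive A c -> exists x, A x = y.
Proof.
  intros [Hc HA]; pose proof (op_norm_ge0 A) as HA0.
  (* Adding [c] to the norm ensures M > 0 and c <= M, even on the zero space. *)
  set (M := op_norm A + c); assert (HM : 0 < M) by (unfold M; lra).
  set (rho := c / M ^ 2).
  assert (HM2 : 0 < M ^ 2) by (apply pow_lt; exact HM).
  assert (Hrho : 0 < rho) by (apply Rdiv_lt_0_compat; lra).
  set (T := minus (bop_one V) (scal rho A) : BoundedOp V).
  set (k := 1 - c ^ 2 / M ^ 2).
  assert (Hk : 0 <= k < 1).
  { unfold k; split.
    - assert (c ^ 2 / M ^ 2 <= 1); [|lra].
      apply Rmult_le_reg_r with (M ^ 2); [lra|].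
      replace (c ^ 2 / M ^ 2 * M ^ 2) with (c ^ 2) by (field; lra).
      unfold M; nra.
    - assert (0 < c ^ 2 / M ^ 2); [|lra].
      apply Rdiv_lt_0_compat; [apply pow_lt|]; lra. }
  assert (HT : forall x, norm (T x) <= sqrt k * norm x).
  { intros x; pose proof (norm_ge_0 x) as Hx; pose proof (norm_ge_0 (A x)) as HAx.
    rewrite <- (sqrt_pow2 (norm x)), <- sqrt_mult by (try apply pow2_ge_0; lra).
    rewrite <- (sqrt_pow2 (norm (T x))) by apply norm_ge_0.
    apply sqrt_le_1_alt; rewrite <- ip_norm.
    change (T x) with (plus x (opp (scal (RtoC rho : C_AbsRing) (A x)))).
    rewrite !ip_plus_l, !ip_plus_r, !ip_opp_l, !ip_opp_r, !ip_scal_real_l, !ip_scal_real_r.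
    rewrite (ip_sym x (A x)), !ip_norm.
    assert (B : norm (A x) <= M * norm x).
    { eapply Rle_trans; [apply op_norm_bound|].
      apply Rmult_le_compat_r; [exact Hx | unfold M; lra]. }
    assert (B2 : norm (A x) ^ 2 <= M ^ 2 * norm x ^ 2).
    { rewrite <- Rpow_mult_distr; apply pow_incr; lra. }
    assert (E : k * norm x ^ 2 = norm x ^ 2 - 2 * rho * (c * norm x ^ 2)
      + rho ^ 2 * (M ^ 2 * norm x ^ 2)) by (unfold k, rho; field; lra).
    rewrite E; specialize (HA x).
    assert (rho * (c * norm x ^ 2) <= rho * ip (A x) x) by (apply Rmult_le_compat_l; lra).
    assert (rho ^ 2 * norm (A x) ^ 2 <= rho ^ 2 * (M ^ 2 * norm x ^ 2))
      by (apply Rmult_le_compat_l; [apply pow2_ge_0 | exact B2]).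
    lra. }
  assert (Hq : 0 <= sqrt k < 1).
  { split; [apply sqrt_pos|]; rewrite <- sqrt_1; apply sqrt_lt_1; lra. }
  destruct (contraction_solve T (sqrt k) y Hq HT) as [x Hx].
  (* Since x - T x = rho A x, the solution is rho x. *)
  exists (scal (RtoC rho : C_AbsRing) x); rewrite bop_at_scal, <- Hx.
  change (T x) with (minus x (scal (RtoC rho : C_AbsRing) (A x))).
  apply ip_ext; intros v; unfold minus.
  rewrite !ip_plus_l, !ip_opp_l, !ip_plus_l, !ip_opp_l; ring.
Qed.

(** The inverse is chosen pointwise by surjectivity; injectivity makes it linear, and coercivity
    bounds it by 1 / c. *)
Lemma coercive_invertible (A : BoundedOp V) c : coercive A c -> bop_invertible A.
Proof.
  intros HA.
  assert (HB : forall y, {x | A x = y}).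
  { intros y; apply constructive_indefinite_description, (coercive_surj A c y HA). }
  set (B := fun y => proj1_sig (HB y)).
  assert (AB : forall y, A (B y) = y) by (intros y; exact (proj2_sig (HB y))).
  assert (HL : is_linear (K := C_AbsRing) (U := V) (V := V) B).
  { split.
    - intros x y; apply (coercive_inj A c); [exact HA|]; rewrite bop_at_plus, !AB; reflexivity.
    - intros k x; apply (coercive_inj A c); [exact HA|]; rewrite bop_at_scal, !AB; reflexivity.
    - pose proof (proj1 HA) as Hc; exists (/ c); split; [apply Rinv_0_lt_compat, Hc|].
      intros x; pose proof (coercive_norm A c (B x) HA) as H; rewrite AB in H.
      apply Rmult_le_reg_l with c; [exact Hc|].
      rewrite <- Rmult_assoc, Rinv_r, Rmult_1_l by lra; exact H. }
  exists (MkBoundedOp HL); split; apply bop_ext; intros x; simpl; [apply AB|].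
  apply (coercive_inj A c); [exact HA | apply AB].
Qed.

(** Invertibility gives |u| <= N |A u|. Cauchy-Schwarz for the form of A, applied to u and A u,
    gives |A u|^2 <= M <A u, u>. Hence |u|^2 <= N^2 M <A u, u>; the added 1 keeps the constant
    invertible when N^2 M = 0. *)
Lemma End_plus_coercive (A : BoundedOp V) : End_plus A -> exists c, coercive A c.
Proof.
  intros [HA HI]; apply nonneg_opP in HA; destruct HA as [HA Hpos].
  set (N := op_norm (bop_inv A)); set (M := op_norm A).
  pose proof (op_norm_ge0 (bop_inv A)) as HN; fold N in HN.
  pose proof (op_norm_ge0 A) as HM; fold M in HM.
  assert (HK : 0 < N ^ 2 * M + 1) by (pose proof (pow2_ge_0 N); nra).
  exists (/ (N ^ 2 * M + 1)); split; [apply Rinv_0_lt_compat, HK|]; intros u.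
  apply Rmult_le_reg_l with (N ^ 2 * M + 1); [exact HK|].
  rewrite <- Rmult_assoc, Rinv_r, Rmult_1_l by lra.
  pose proof (norm_ge_0 u) as Hu; pose proof (norm_ge_0 (A u)) as HAu.
  assert (H1 : norm u <= N * norm (A u)).
  { rewrite <- (bop_inv_l A u HI) at 1; apply op_norm_bound. }
  assert (H2 : norm (A u) ^ 2 <= M * ip (A u) u).
  { pose proof (form_Cauchy_Schwarz A u (A u) HA Hpos) as H; rewrite ip_norm in H.
    assert (K : ip (A (A u)) (A u) <= M * norm (A u) ^ 2).
    { pose proof (ip_bound (A (A u)) (A u)) as K; apply Rle_trans with (1 := Rle_abs _).
      eapply Rle_trans; [exact K|].
      pose proof (op_norm_bound A (A u)) as K2; fold M in K2; nra. }
    specialize (Hpos u).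
    destruct (Req_dec (norm (A u)) 0) as [E | E]; [rewrite E; nra|].
    apply Rmult_le_reg_r with (norm (A u) ^ 2); [apply pow_lt; lra | nra]. }
  assert (H3 : norm u ^ 2 <= N ^ 2 * norm (A u) ^ 2).
  { rewrite <- Rpow_mult_distr; apply pow_incr; lra. }
  assert (H4 : N ^ 2 * norm (A u) ^ 2 <= N ^ 2 * (M * ip (A u) u))
    by (apply Rmult_le_compat_l; [apply pow2_ge_0 | exact H2]).
  specialize (Hpos u); lra.
Qed.

(* Completing the square. *)
Lemma schur_complement (Q D E A : BoundedOp V) (u w : V) :
  adjoint A A -> bop_invertible A -> adjoint D E ->
  ip (Q u) u + 2 * ip (D w) u + ip (A w) w =
  ip (minus Q (bop_comp D (bop_comp (bop_inv A) E)) u) u +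
  ip (A (plus w (bop_inv A (E u)))) (plus w (bop_inv A (E u))).
Proof.
  intros HA HI HD; rewrite bop_minus_apply; simpl.
  set (x := bop_inv A (E u)); assert (Hx : A x = E u) by apply bop_inv_r, HI.
  unfold minus; rewrite bop_at_plus, !ip_plus_l, !ip_plus_r, ip_opp_l.
  rewrite (HA w x), Hx, (ip_sym (E u) w), (ip_sym (E u) x), <- !HD; ring.
Qed.

Lemma adjoint_schur (D E A : BoundedOp V) :
  adjoint A A -> bop_invertible A -> adjoint D E ->
  adjoint (bop_comp D (bop_comp (bop_inv A) E)) (bop_comp D (bop_comp (bop_inv A) E)).
Proof.
  intros HA HI HD u v; simpl.
  rewrite HD, (adjoint_inv A HI HA), (adjoint_sym D E HD); reflexivity.
Qed.

End RealInner.

Arguments ip {V} u v.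
Arguments adjoint {V} A B.
Arguments coercive {V} A c.

(** * Operator-valued functions through their entries *)

(** A linear map commutes with Riemann sums, and boundedness lets it pass to the limit. *)
Lemma is_RInt_linear (U W : NormedModule R_AbsRing) (l : U -> W) (f : R -> U) (a b : R) (I : U) :
  is_linear l -> is_RInt f a b I -> is_RInt (fun t => l (f t)) a b (l I).
Proof.
  intros Hl HI; unfold is_RInt in *.
  apply filterlim_ext with (fun ptd => l (scal (sign (b - a)) (Riemann_sum f ptd))).
  - intros ptd; rewrite (linear_scal l Hl); f_equal.
    apply (SF_cons_ind (fun s => l (Riemann_sum f s) = Riemann_sum (fun t => l (f t)) s)).
    + intros x; apply (linear_zero l Hl).
    + intros h s IH; rewrite !Riemann_sum_cons, (linear_plus l Hl), (linear_scal l Hl), IH.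
      reflexivity.
  - eapply filterlim_comp; [exact HI | apply linear_cont, Hl].
Qed.

Section Functionals.

Variable V : HilbertSpace.

Lemma bop_weak_ext (A B : BoundedOp V) : (forall u v, ip (A u) v = ip (B u) v) -> A = B.
Proof. intros H; apply bop_ext; intros u; apply ip_ext; intros v; apply H. Qed.

Lemma is_linear_ip (u v : V) :
  is_linear (K := R_AbsRing) (U := bop_NormedModule V) (V := R_NormedModule)
    (fun A : BoundedOp V => ip (A u) v).
Proof.
  split.
  - intros A B; apply ip_plus_l.
  - intros r A; apply (ip_scal_real_l V r (A u) v).
  - pose proof (norm_ge_0 u) as Hu; pose proof (norm_ge_0 v) as Hv.
    exists (norm u * norm v + 1); split; [nra|]; intros A.
    change (Rabs (ip (A u) v) <= (norm u * norm v + 1) * op_norm A).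
    eapply Rle_trans; [apply ip_bound|].
    pose proof (op_norm_bound A u); pose proof (op_norm_ge0 A).
    apply Rle_trans with (op_norm A * norm u * norm v); [|nra].
    apply Rmult_le_compat_r; assumption.
Qed.

Lemma is_linear_cscal (c : C) :
  is_linear (K := R_AbsRing) (U := bop_NormedModule V) (V := bop_NormedModule V) (bop_cscal c).
Proof.
  split.
  - intros A B; apply bop_ext; intros x; apply (@scal_distr_l C_AbsRing V).
  - intros r A; apply bop_ext; intros x.
    change (scal (c : C_AbsRing) (scal (RtoC r : C_AbsRing) (A x)) =
      scal (RtoC r : C_AbsRing) (scal (c : C_AbsRing) (A x))).
    rewrite !(@scal_assoc C_AbsRing V); f_equal; apply Cmult_comm.
  - exists (Cmod c + 1); pose proof (Cmod_ge_0 c); split; [lra|]; intros A.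
    change (op_norm (bop_cscal c A) <= (Cmod c + 1) * op_norm A).
    pose proof (op_norm_cscal c A); pose proof (op_norm_ge0 A); lra.
Qed.

Lemma is_derive_linear (U W : NormedModule R_AbsRing) (l : U -> W) (f : R -> U) (x : R) (df : U) :
  is_linear l -> is_derive f x df -> is_derive (fun t => l (f t)) x (l df).
Proof.
  intros Hl Hf; unfold is_derive in *.
  apply filterdiff_ext_lin with (fun y => l (scal y df)).
  - apply (filterdiff_comp' f l); [exact Hf | apply filterdiff_linear, Hl].
  - intros y; apply (linear_scal l Hl).
Qed.

Lemma is_derive_ip (f : R -> BoundedOp V) (x : R) (L : BoundedOp V) (u v : V) :
  is_derive f x L -> is_derive (fun t => ip (f t u) v) x (ip (L u) v).
Proof. exact (is_derive_linear _ _ _ f x L (is_linear_ip u v)). Qed.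

(** This evaluates the definite descriptions in [dx] and [dy]. Uniqueness is inherited from real
    derivatives, since entries determine the operator. *)
Lemma is_derive_bop_unique (f : R -> BoundedOp V) (x : R) (L : BoundedOp V) :
  is_derive f x L -> iota (is_derive f x) = L.
Proof.
  intros HL.
  assert (U : forall L', is_derive f x L' -> L = L').
  { intros L' HL'; apply bop_weak_ext; intros u v.
    apply (is_derive_ip _ _ _ u v) in HL; apply (is_derive_ip _ _ _ u v) in HL'.
    apply is_derive_unique in HL; apply is_derive_unique in HL'; congruence. }
  symmetry; apply U.
  exact (iota_correct (V := bop_CompleteNormedModule V) (is_derive f x)
    (ex_intro _ L (conj HL U))).
Qed.

Lemma dx_correct (Q : C -> BoundedOp V) (z : C) :
  ex_partials Q z -> is_derive (fun t => Q (t, Im z)) (Re z) (dx Q z).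
Proof. intros [[L HL] _]; 
  replace (dx Q z) with L; [exact HL | symmetry; exact (is_derive_bop_unique _ _ L HL)]. Qed.

Lemma dy_correct (Q : C -> BoundedOp V) (z : C) :
  ex_partials Q z -> is_derive (fun t => Q (Re z, t)) (Im z) (dy Q z).
Proof. intros [_ [L HL]]; 
  replace (dy Q z) with L; [exact HL | symmetry; exact (is_derive_bop_unique _ _ L HL)]. Qed.

Definition entry (Q : C -> BoundedOp V) (u v : V) (x y : R) : R := ip (Q (x, y) u) v.

Lemma continuity_2d_entry (Q : C -> BoundedOp V) (u v : V) (x y : R) :
  continuous Q (x, y) -> continuity_2d_pt (entry Q u v) x y.
Proof.
  intros HQ; apply continuity_2d_pt_filterlim.
  apply filterlim_ext with (fun z : C => ip (Q z u) v); [intros [s t]; reflexivity|].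
  exact (continuous_comp Q (fun A => ip (A u) v) (x, y) HQ (linear_cont _ _ (is_linear_ip u v))).
Qed.

Lemma C1_on_entry (Omega : C -> Prop) (Q : C -> BoundedOp V) (u v : V) :
  (forall z, Omega z -> ex_partials Q z) ->
  (forall z, Omega z -> continuous (dx Q) z) -> (forall z, Omega z -> continuous (dy Q) z) ->
  C1_on Omega (entry Q u v) (entry (dx Q) u v) (entry (dy Q) u v).
Proof.
  intros HQ Hx Hy x y Hz; refine (conj _ (conj _ (conj _ _))).
  - apply is_derive_ip, (dx_correct Q (x, y)), HQ, Hz.
  - apply is_derive_ip, (dy_correct Q (x, y)), HQ, Hz.
  - apply continuity_2d_entry, Hx, Hz.
  - apply continuity_2d_entry, Hy, Hz.
Qed.

Definition entry_jet (Q : C -> BoundedOp V) (u v : V) : jet2 :=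
  Jet2 (entry Q u v) (entry (dx Q) u v) (entry (dy Q) u v) (entry (dx (dx Q)) u v)
    (entry (dy (dx Q)) u v) (entry (dx (dy Q)) u v) (entry (dy (dy Q)) u v).

Lemma C2_on_entry (Omega : C -> Prop) (Q : C -> BoundedOp V) (u v : V) :
  Ck_on 2 Omega Q -> C2_on Omega (entry_jet Q u v).
Proof.
  intros (_ & Q1 & (X0 & X1 & [Xx _] & [Xy _]) & (Y0 & Y1 & [Yx _] & [Yy _])).
  split; [|split]; apply C1_on_entry; assumption.
Qed.

(** The scalar Schwarz theorem applied to every entry. *)
Lemma mixed_partials (Omega : C -> Prop) (Q : C -> BoundedOp V) (z : C) :
  open Omega -> Ck_on 2 Omega Q -> Omega z -> dx (dy Q) z = dy (dx Q) z.
Proof.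
  intros HO HQ Hz; apply bop_weak_ext; intros u v.
  destruct z as [x y]; pose proof (open_locally_2d Omega x y HO Hz) as HL.
  destruct (C2_on_entry Omega Q u v HQ) as (J1 & J2 & J3); simpl in J1, J2, J3.
  assert (Ey : forall s t, Omega (s, t) -> Derive (entry Q u v s) t = entry (dy Q) u v s t)
    by (intros s t H; apply is_derive_unique, (J1 s t H)).
  assert (Ex : forall s t, Omega (s, t) ->
    Derive (fun s => entry Q u v s t) s = entry (dx Q) u v s t)
    by (intros s t H; apply is_derive_unique, (J1 s t H)).
  assert (Dxy : forall s t, Omega (s, t) ->
    is_derive (fun s => Derive (entry Q u v s) t) s (entry (dx (dy Q)) u v s t)).
  { intros s t H; apply is_derive_ext_loc with (fun s => entry (dy Q) u v s t).
    - pose proof (locally_2d_1d_const_y _ _ _ (open_locally_2d Omega s t HO H)) as H'.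
      apply filter_imp with (2 := H'); intros s' Hs'; symmetry; apply Ey, Hs'.
    - apply (J3 s t H). }
  assert (Dyx : forall s t, Omega (s, t) ->
    is_derive (fun t => Derive (fun s => entry Q u v s t) s) t (entry (dy (dx Q)) u v s t)).
  { intros s t H; apply is_derive_ext_loc with (fun t => entry (dx Q) u v s t).
    - pose proof (locally_2d_1d_const_x _ _ _ (open_locally_2d Omega s t HO H)) as H'.
      apply filter_imp with (2 := H'); intros t' Ht'; symmetry; apply Ex, Ht'.
    - apply (J2 s t H). }
  change (entry (dx (dy Q)) u v x y = entry (dy (dx Q)) u v x y).
  rewrite <- (is_derive_unique _ _ _ (Dxy x y Hz)), <- (is_derive_unique _ _ _ (Dyx x y Hz)).
  apply (Schwarz (entry Q u v)).
  - apply locally_2d_impl with (2 := HL); apply locally_2d_forall; intros s t H.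
    repeat split; eexists;
      [apply (J1 s t H) | apply (J1 s t H) | apply (Dxy s t H) | apply (Dyx s t H)].
  - apply continuity_2d_pt_ext_loc with (entry (dx (dy Q)) u v); [|apply (J3 x y Hz)].
    apply locally_2d_impl with (2 := HL); apply locally_2d_forall; intros s t H.
    symmetry; apply is_derive_unique, Dxy, H.
  - apply continuity_2d_pt_ext_loc with (entry (dy (dx Q)) u v); [|apply (J2 x y Hz)].
    apply locally_2d_impl with (2 := HL); apply locally_2d_forall; intros s t H.
    symmetry; apply is_derive_unique, Dyx, H.
Qed.

(** The terms with factor i cancel because the mixed partials agree, which leaves a quarter of the
    Laplacian. *)
Lemma d_zbar_d_z (Omega : C -> Prop) (Q : C -> BoundedOp V) (z : C) :
  open Omega -> Ck_on 2 Omega Q -> Omega z ->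
  d_zbar (d_z Q) z = scal (1 / 4) (plus (dx (dx Q) z) (dy (dy Q) z)).
Proof.
  intros HO HQ Hz; pose proof (mixed_partials Omega Q z HO HQ Hz) as Exy.
  destruct HQ as (_ & Q1 & (X0 & X1 & _) & (Y0 & Y1 & _)).
  assert (Lin : forall f g : R -> BoundedOp V, forall x A B,
    is_derive f x A -> is_derive g x B ->
    is_derive (fun t => bop_cscal (RtoC (1 / 2)) (minus (f t) (bop_cscal Ci (g t)))) x
      (bop_cscal (RtoC (1 / 2)) (minus A (bop_cscal Ci B)))).
  { intros f g x A B Hf Hg; apply (is_derive_linear _ _ _ _ _ _ (is_linear_cscal _)).
    apply (is_derive_minus f (fun t => bop_cscal Ci (g t))); [exact Hf|].
    exact (is_derive_linear _ _ _ _ _ _ (is_linear_cscal _) Hg). }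
  assert (Ex : dx (d_z Q) z =
    bop_cscal (RtoC (1 / 2)) (minus (dx (dx Q) z) (bop_cscal Ci (dx (dy Q) z)))).
  { apply is_derive_bop_unique.
    apply (Lin (fun t => dx Q (t, Im z)) (fun t => dy Q (t, Im z)));
      apply dx_correct; [apply X1 | apply Y1]; exact Hz. }
  assert (Ey : dy (d_z Q) z =
    bop_cscal (RtoC (1 / 2)) (minus (dy (dx Q) z) (bop_cscal Ci (dy (dy Q) z)))).
  { apply is_derive_bop_unique.
    apply (Lin (fun t => dx Q (Re z, t)) (fun t => dy Q (Re z, t)));
      apply dy_correct; [apply X1 | apply Y1]; exact Hz. }
  unfold d_zbar; rewrite Ex, Ey, Exy; apply bop_weak_ext; intros u v.
  set (A := dx (dx Q) z); set (B := dy (dx Q) z); set (D := dy (dy Q) z).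
  change (ip (scal (RtoC (1 / 2) : C_AbsRing)
    (plus (scal (RtoC (1 / 2) : C_AbsRing) (plus (A u) (opp (scal (Ci : C_AbsRing) (B u)))))
      (scal (Ci : C_AbsRing) (scal (RtoC (1 / 2) : C_AbsRing)
        (plus (B u) (opp (scal (Ci : C_AbsRing) (D u)))))))) v =
    ip (scal (RtoC (1 / 4) : C_AbsRing) (plus (A u) (D u))) v).
  rewrite !ip_scal_real_l, !ip_plus_l, !ip_scal_real_l, !ip_plus_l, !ip_opp_l.
  rewrite (ip_scal_conj V Ci (scal _ _)), ip_scal_real_l, ip_plus_l, ip_opp_l.
  rewrite <- !(ip_scal_conj V Ci), (@scal_assoc C_AbsRing V).
  replace (mult (Ci : C_AbsRing) (Ci : C_AbsRing)) with (RtoC (-1))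
    by (apply injective_projections; simpl; ring).
  rewrite ip_scal_real_l; field.
Qed.

(** Self-adjointness says that the entries at (u, v) and (v, u) coincide. [Omega] being open, they
    coincide near each point, and so do their derivatives. *)
Lemma adjoint_partials (Omega : C -> Prop) (Q : C -> BoundedOp V) :
  open Omega -> (forall z, Omega z -> ex_partials Q z) ->
  (forall z, Omega z -> adjoint (Q z) (Q z)) ->
  forall z, Omega z -> adjoint (dx Q z) (dx Q z) /\ adjoint (dy Q z) (dy Q z).
Proof.
  intros HO HQ HA [x y] Hz; pose proof (open_locally_2d Omega x y HO Hz) as HL.
  split; intros u v; rewrite (ip_sym V u).
  - pose proof (dx_correct Q _ (HQ _ Hz)) as D; simpl in D.
    rewrite <- (is_derive_unique _ _ _ (is_derive_ip _ _ _ u v D)),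
      <- (is_derive_unique _ _ _ (is_derive_ip _ _ _ v u D)).
    apply Derive_ext_loc; apply locally_2d_1d_const_y in HL.
    apply filter_imp with (2 := HL); intros t Ht; rewrite (HA _ Ht), ip_sym; reflexivity.
  - pose proof (dy_correct Q _ (HQ _ Hz)) as D; simpl in D.
    rewrite <- (is_derive_unique _ _ _ (is_derive_ip _ _ _ u v D)),
      <- (is_derive_unique _ _ _ (is_derive_ip _ _ _ v u D)).
    apply Derive_ext_loc; apply locally_2d_1d_const_x in HL.
    apply filter_imp with (2 := HL); intros t Ht; rewrite (HA _ Ht), ip_sym; reflexivity.
Qed.

Definition affine_vec (u w : V) (x y : R) : V := plus u (scal ((x, y) : C_AbsRing) w).

Lemma scal_coord (x y : R) (w : V) :
  scal ((x, y) : C_AbsRing) w =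
  plus (scal (RtoC x : C_AbsRing) w) (scal (RtoC y : C_AbsRing) (scal (Ci : C_AbsRing) w)).
Proof.
  rewrite (@scal_assoc C_AbsRing V), <- (@scal_distr_r C_AbsRing V); f_equal.
  apply injective_projections; simpl; ring.
Qed.

Lemma ip_Ci (u v : V) : ip (scal (Ci : C_AbsRing) u) (scal (Ci : C_AbsRing) v) = ip u v.
Proof.
  rewrite ip_scal_conj, (@scal_assoc C_AbsRing V).
  replace (mult (Cconj Ci : C_AbsRing) (Ci : C_AbsRing)) with (RtoC 1)
    by (apply injective_projections; simpl; ring).
  rewrite ip_scal_real_r; ring.
Qed.

(** The left side is the imaginary part of [inner (A w) w], which is real. *)
Lemma adjoint_ip_Ci (A : BoundedOp V) (w : V) :
  adjoint A A -> ip (A w) (scal (Ci : C_AbsRing) w) = 0.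
Proof.
  intros HA.
  assert (E : ip (A w) (scal (Ci : C_AbsRing) w) = - ip (A w) (scal (Ci : C_AbsRing) w)).
  { transitivity (ip w (scal (Ci : C_AbsRing) (A w))); [rewrite HA, (bop_at_scal A); reflexivity|].
    rewrite ip_sym, <- ip_Ci, (@scal_assoc C_AbsRing V).
    replace (mult (Ci : C_AbsRing) (Ci : C_AbsRing)) with (RtoC (-1))
      by (apply injective_projections; simpl; ring).
    rewrite ip_scal_real_l; ring. }
  lra.
Qed.

(** For fixed x and y only entries of [A] remain on the right; this expansion is the model for
    [affine_jet]. *)
Lemma form_affine (A : BoundedOp V) (u w : V) (x y : R) :
  adjoint A A ->
  ip (A (affine_vec u w x y)) (affine_vec u w x y) =
  ip (A u) u + 2 * x * ip (A w) u + 2 * y * ip (A (scal (Ci : C_AbsRing) w)) u +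
  (x * x + y * y) * ip (A w) w.
Proof.
  intros HA; unfold affine_vec; rewrite scal_coord.
  rewrite !bop_at_plus, !(bop_at_scal A (RtoC _)), !ip_plus_l, !ip_plus_r,
    !ip_scal_real_l, !ip_scal_real_r.
  assert (E1 : ip (A u) w = ip (A w) u) by (rewrite HA, ip_sym; reflexivity).
  assert (E2 : ip (A u) (scal (Ci : C_AbsRing) w) = ip (A (scal (Ci : C_AbsRing) w)) u)
    by (rewrite HA, ip_sym; reflexivity).
  assert (E3 : ip (A (scal (Ci : C_AbsRing) w)) w = 0)
    by (rewrite HA, ip_sym; apply adjoint_ip_Ci, HA).
  rewrite E1, E2, E3, (adjoint_ip_Ci A w HA), (bop_at_scal A Ci), ip_Ci.
  ring.
Qed.

(** The right side of [form_affine] with A = P(z) and (x, y) the coordinates of z - a. It agrees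
    with g where P(z) is self-adjoint, in particular on [Omega]. *)
Definition affine_jet (P : C -> BoundedOp V) (a : C) (u w : V) : jet2 :=
  jet_plus (jet_plus (entry_jet P u u)
      (jet_mult (jet_mult (jet_const 2) (jet_fst (fst a))) (entry_jet P w u)))
    (jet_plus
      (jet_mult (jet_mult (jet_const 2) (jet_snd (snd a)))
        (entry_jet P (scal (Ci : C_AbsRing) w) u))
      (jet_mult (jet_plus (jet_mult (jet_fst (fst a)) (jet_fst (fst a)))
                          (jet_mult (jet_snd (snd a)) (jet_snd (snd a))))
        (entry_jet P w w))).

End Functionals.

Arguments entry {V} Q u v x y.
Arguments entry_jet {V} Q u v.
Arguments affine_vec {V} u w x y.
Arguments affine_jet {V} P a u w.

(** * The circular means of affine sections *)

Section Curvature.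

Variables (V : HilbertSpace) (Omega : C -> Prop) (P : C -> BoundedOp V).
Hypothesis HO : open Omega.
Hypothesis HP : forall z, Omega z -> End_plus (P z).
Hypothesis HS : smooth_on Omega P.

Lemma adjoint_P z : Omega z -> adjoint (P z) (P z).
Proof. intros Hz; apply self_adjointP, (HP z Hz). Qed.

Lemma pos_P z u : Omega z -> 0 <= ip (P z u) u.
Proof. intros Hz; apply (HP z Hz). Qed.

Lemma affine_jet_value a u w x y :
  Omega (x, y) ->
  j0 (affine_jet P a u w) x y =
  ip (P (x, y) (affine_vec u w (x - fst a) (y - snd a))) (affine_vec u w (x - fst a) (y - snd a)).
Proof.
  intros Hz; rewrite form_affine by (apply adjoint_P, Hz); simpl; unfold entry; ring.
Qed.

Lemma C2_on_affine_jet a u w : C2_on Omega (affine_jet P a u w).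
Proof.
  pose proof (C2_on_fst Omega (fst a)) as H1; pose proof (C2_on_snd Omega (snd a)) as H2.
  pose proof (fun u v => C2_on_entry V Omega P u v (HS 2%nat)) as HE.
  pose proof (C2_on_const Omega 2) as H0.
  unfold affine_jet; apply C2_on_plus; [apply C2_on_plus | apply C2_on_plus].
  - apply HE.
  - exact (C2_on_mult _ _ _ HO (C2_on_mult _ _ _ HO H0 H1) (HE w u)).
  - exact (C2_on_mult _ _ _ HO (C2_on_mult _ _ _ HO H0 H2) (HE _ u)).
  - exact (C2_on_mult _ _ _ HO (C2_on_plus _ _ _ (C2_on_mult _ _ _ HO H1 H1)
      (C2_on_mult _ _ _ HO H2 H2)) (HE w w)).
Qed.

Lemma adjoint_derivatives z :
  Omega z ->
  adjoint (dx P z) (dx P z) /\ adjoint (dy P z) (dy P z) /\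
  adjoint (dx (dx P) z) (dx (dx P) z) /\ adjoint (dy (dy P) z) (dy (dy P) z).
Proof.
  destruct (HS 2%nat) as (_ & Q1 & (X0 & X1 & _) & (Y0 & Y1 & _)).
  pose proof (adjoint_partials V Omega P HO Q1 adjoint_P) as H1.
  pose proof (adjoint_partials V Omega (dx P) HO X1 (fun z Hz => proj1 (H1 z Hz))) as H2.
  pose proof (adjoint_partials V Omega (dy P) HO Y1 (fun z Hz => proj2 (H1 z Hz))) as H3.
  intros Hz; exact (conj (proj1 (H1 z Hz)) (conj (proj2 (H1 z Hz))
    (conj (proj1 (H2 z Hz)) (proj2 (H3 z Hz))))).
Qed.

Lemma adjoint_d_zbar z : Omega z -> adjoint (d_zbar P z) (d_z P z).
Proof.
  intros Hz; destruct (adjoint_derivatives z Hz) as (A1 & A2 & _).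
  intros u v; unfold d_zbar, d_z.
  change (ip (scal (RtoC (1 / 2) : C_AbsRing)
      (plus (dx P z u) (scal (Ci : C_AbsRing) (dy P z u)))) v =
    ip u (scal (RtoC (1 / 2) : C_AbsRing)
      (plus (dx P z v) (opp (scal (Ci : C_AbsRing) (dy P z v)))))).
  rewrite ip_scal_real_l, ip_scal_real_r, ip_plus_l, ip_plus_r, ip_opp_r, A1.
  rewrite ip_scal_conj, A2, (bop_at_scal (dy P z)).
  replace (Cconj Ci) with (Cmult (RtoC (-1)) Ci) by (apply injective_projections; simpl; ring).
  rewrite <- (@scal_assoc C_AbsRing V (RtoC (-1)) Ci), ip_scal_real_r; ring.
Qed.

Lemma adjoint_d_zbar_d_z z : Omega z -> adjoint (d_zbar (d_z P) z) (d_zbar (d_z P) z).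
Proof.
  intros Hz; destruct (adjoint_derivatives z Hz) as (_ & _ & A1 & A2).
  rewrite (d_zbar_d_z V Omega P z HO (HS 2%nat) Hz); apply adjoint_scal, adjoint_plus; assumption.
Qed.

(** The section u + (z - a) w is holomorphic with derivative w. Applying d_zbar d_z to g therefore
    gives the form of P_{z zbar} at v, the form of P at w, and the two conjugate cross terms <P_z v,
    w> and <P_zbar w, v>. *)
Lemma lap_affine_jet a u w x y :
  Omega (x, y) ->
  let v := affine_vec u w (x - fst a) (y - snd a) in
  lap (affine_jet P a u w) x y =
  4 * (ip (d_zbar (d_z P) (x, y) v) v + 2 * ip (d_zbar P (x, y) w) v + ip (P (x, y) w) w).
Proof.
  intros Hz v; destruct (adjoint_derivatives _ Hz) as (A1 & A2 & A3 & A4).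
  rewrite (d_zbar_d_z V Omega P _ HO (HS 2%nat) Hz).
  set (L := plus (dx (dx P) (x, y)) (dy (dy P) (x, y))).
  assert (HL : adjoint L L) by (apply adjoint_plus; assumption).
  change (ip (scal (1 / 4) L v) v) with (ip (scal (RtoC (1 / 4) : C_AbsRing) (L v)) v).
  change (d_zbar P (x, y) w) with (scal (RtoC (1 / 2) : C_AbsRing)
    (plus (dx P (x, y) w) (scal (Ci : C_AbsRing) (dy P (x, y) w)))).
  rewrite !ip_scal_real_l, ip_plus_l; unfold v at 1 2; rewrite (form_affine V L) by exact HL.
  rewrite <- (bop_at_scal (dy P (x, y))).
  unfold v, affine_vec; rewrite scal_coord, !ip_plus_r, !ip_scal_real_r.
  rewrite (adjoint_ip_Ci V _ w A1), (bop_at_scal (dy P (x, y)) _ w), ip_Ci.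
  assert (E : ip (scal (Ci : C_AbsRing) (dy P (x, y) w)) w = 0).
  { rewrite <- (bop_at_scal (dy P (x, y))), A2, ip_sym; apply adjoint_ip_Ci, A2. }
  rewrite E, <- (bop_at_scal (dy P (x, y)) _ w).
  assert (EL : forall p q, ip (L p) q =
    ip (dx (dx P) (x, y) p) q + ip (dy (dy P) (x, y) p) q) by (intros p q; apply ip_plus_l).
  rewrite !EL; unfold lap; simpl; unfold entry; field.
Qed.

(** A quadratic form in (u, w) whose w-block is positive and invertible is nonnegative exactly when
    its Schur complement is. *)
Lemma seminegative_curvatureP :
  seminegative_curvature Omega P <->
  forall z u w, Omega z ->
    0 <= ip (d_zbar (d_z P) z u) u + 2 * ip (d_zbar P z w) u + ip (P z w) w.
Proof.
  set (S := fun z => bop_comp (d_zbar P z) (bop_comp (bop_inv (P z)) (d_z P z))).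
  assert (HSq : forall z u, ip (minus zero (minus (S z) (d_zbar (d_z P) z)) u) u =
    ip (minus (d_zbar (d_z P) z) (S z) u) u).
  { intros z u; f_equal; change (minus zero (minus (S z u) (d_zbar (d_z P) z u)) =
      minus (d_zbar (d_z P) z u) (S z u)).
    apply ip_ext; intros v; unfold minus.
    rewrite !ip_plus_l, !ip_opp_l, ip_plus_l, ip_opp_l, ip_zero_l; ring. }
  split; intros H.
  - intros z u w Hz; specialize (H z Hz); apply nonneg_opP in H; destruct H as [_ H].
    rewrite (schur_complement V _ _ (d_z P z));
      [|apply adjoint_P, Hz | apply (HP z Hz) | apply adjoint_d_zbar, Hz].
    apply Rplus_le_le_0_compat; [|apply pos_P, Hz].
    exact (Rle_trans _ _ _ (H u) (Req_le _ _ (HSq z u))).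
  - intros z Hz; apply nonneg_opP; split.
    + apply adjoint_minus; [intros u v; simpl|].
      * rewrite (ip_sym V u), !ip_zero_l; reflexivity.
      * apply adjoint_minus; [|apply adjoint_d_zbar_d_z, Hz].
        apply adjoint_schur; [apply adjoint_P, Hz | apply (HP z Hz) | apply adjoint_d_zbar, Hz].
    + intros u; apply Rle_trans with (2 := Req_le _ _ (eq_sym (HSq z u))).
      (* The minimising w makes the completed square vanish. *)
      specialize (H z u (opp (bop_inv (P z) (d_z P z u))) Hz).
      rewrite (schur_complement V _ _ (d_z P z)) in H;
        [|apply adjoint_P, Hz | apply (HP z Hz) | apply adjoint_d_zbar, Hz].
      rewrite (@plus_opp_l V), bop_at_zero, ip_zero_l, Rplus_0_r in H; exact H.
Qed.

(** * The integrals over a fixed circle and the minimum formula *)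

Section Circle.

Variables (a : C) (r : R).
Hypothesis Hdisc : closed_disc_in Omega a r.

Let rpos : 0 < r := proj1 Hdisc.

Lemma circle_Omega t : Omega (circle a r t).
Proof. eapply circle_in_disc; [exact Hdisc | lra]. Qed.

Lemma continuous_P_circle t : continuous (fun t => P (circle a r t)) t.
Proof.
  apply continuous_ext with (fun t => P (fst a + r * cos t, snd a + r * sin t)).
  { intros s; rewrite circle_coord; reflexivity. }
  apply (continuous_comp_2 (fun t => fst a + r * cos t) (fun t => snd a + r * sin t)
    (fun x y => P (x, y))).
  - apply (ex_derive_continuous (V := R_NormedModule)); auto_derive; trivial.
  - apply (ex_derive_continuous (V := R_NormedModule)); auto_derive; trivial.
  - apply continuous_ext with P; [intros [x y]; reflexivity|].
    rewrite <- circle_coord; apply (HS 0%nat), circle_Omega.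
Qed.

(** Only the real module structure on operators is canonical, so the complex factor is split into
    real and imaginary parts. *)
Lemma continuous_cscal_P_circle (c : R -> C) t :
  continuous (fun t => fst (c t)) t -> continuous (fun t => snd (c t)) t ->
  continuous (fun t => bop_cscal (c t) (P (circle a r t))) t.
Proof.
  intros H1 H2.
  apply continuous_ext with (fun t => plus (scal (fst (c t)) (P (circle a r t)))
    (scal (snd (c t)) (bop_cscal Ci (P (circle a r t))))).
  { intros s; apply bop_ext; intros x.
    symmetry; etransitivity; [|apply scal_coord]; simpl; f_equal; apply surjective_pairing. }
  apply (continuous_plus (V := bop_NormedModule V)).
  - apply (continuous_scal (V := bop_NormedModule V)); [exact H1 | apply continuous_P_circle].
  - apply (continuous_scal (V := bop_NormedModule V)); [exact H2|].
    apply (continuous_comp (fun t => P (circle a r t)) (bop_cscal Ci)).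
    + apply continuous_P_circle.
    + exact (linear_cont _ _ (is_linear_cscal V Ci)).
Qed.

Lemma is_RInt_ip_circle (f : R -> BoundedOp V) (u v : V) :
  (forall t, continuous f t) ->
  is_RInt (fun t => ip (f t u) v) 0 (2 * PI) (ip (RInt f 0 (2 * PI) u) v).
Proof.
  intros Hf.
  apply (is_RInt_linear (bop_NormedModule V) R_NormedModule (fun A : BoundedOp V => ip (A u) v)).
  - apply is_linear_ip.
  - apply (RInt_correct (V := bop_CompleteNormedModule V)),
      (ex_RInt_continuous (V := bop_CompleteNormedModule V)); intros t _; apply Hf.
Qed.

Lemma is_RInt_arc u v :
  is_RInt (fun t => r * ip (P (circle a r t) u) v) 0 (2 * PI) (ip (circle_int_arc P a r u) v).
Proof.
  apply is_RInt_ext with (fun t => ip (scal r (P (circle a r t)) u) v).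
  { intros t _; apply ip_scal_real_l. }
  apply is_RInt_ip_circle; intros t.
  apply (continuous_scal_r (V := bop_NormedModule V)), continuous_P_circle.
Qed.

Lemma is_RInt_dz u v :
  is_RInt (fun t => ip (bop_cscal (Cmult Ci (Cmult r (cos t, sin t))) (P (circle a r t)) u) v)
    0 (2 * PI) (ip (circle_int_dz P a r u) v).
Proof.
  apply is_RInt_ip_circle; intros t; apply continuous_cscal_P_circle;
    apply (ex_derive_continuous (V := R_NormedModule)); simpl; auto_derive; trivial.
Qed.

Lemma is_RInt_dzbar u v :
  is_RInt (fun t => ip (bop_cscal (Cconj (Cmult Ci (Cmult r (cos t, sin t))))
    (P (circle a r t)) u) v) 0 (2 * PI) (ip (circle_int_dzbar P a r u) v).
Proof.
  apply is_RInt_ip_circle; intros t; apply continuous_cscal_P_circle;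
    apply (ex_derive_continuous (V := R_NormedModule)); simpl; auto_derive; trivial.
Qed.

Lemma is_RInt_R_unique (f g : R -> R) (p q I J : R) :
  (forall t, f t = g t) -> is_RInt f p q I -> is_RInt g p q J -> I = J.
Proof.
  intros E HI HJ; apply (is_RInt_unique (V := R_CompleteNormedModule)) in HI, HJ.
  rewrite <- HI, <- HJ; apply RInt_ext; intros t _; apply E.
Qed.

Lemma adjoint_arc : adjoint (circle_int_arc P a r) (circle_int_arc P a r).
Proof.
  intros u v; rewrite (ip_sym V u).
  refine (is_RInt_R_unique _ _ _ _ _ _ _ (is_RInt_arc u v) (is_RInt_arc v u)).
  intros t; rewrite (adjoint_P _ (circle_Omega t)), ip_sym; reflexivity.
Qed.

Lemma adjoint_dz : adjoint (circle_int_dz P a r) (circle_int_dzbar P a r).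
Proof.
  intros u v; rewrite (ip_sym V u).
  refine (is_RInt_R_unique _ _ _ _ _ _ _ (is_RInt_dz u v) (is_RInt_dzbar v u)).
  intros t; rewrite (adjoint_cscal V _ _ _ (adjoint_P _ (circle_Omega t))), ip_sym; reflexivity.
Qed.

(** One coercivity constant suffices: with c the constant of P at angle 0, continuity keeps c / 2 on
    a short arc [0, e], and the integrand is nonnegative on the rest. *)
Lemma arc_coercive : exists c, coercive (circle_int_arc P a r) c.
Proof.
  pose proof PI_RGT_0.
  destruct (End_plus_coercive V _ (HP _ (circle_Omega 0))) as (c & Hc & Hcoer).
  assert (Hc2 : 0 < c / 2) by lra.
  destruct (proj1 (filterlim_locally _ _) (continuous_P_circle 0) (mkposreal _ Hc2)) as [d Hd].
  pose proof (cond_pos d) as Hdpos.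
  (* This keeps e < d, for continuity, and e < 2 pi, to stay within one turn. *)
  set (e := Rmin (d / 2) PI).
  assert (He : 0 < e) by (apply Rmin_pos; lra).
  assert (Hed : e < d) by (pose proof (Rmin_l (d / 2) PI); unfold e; lra).
  assert (He2 : e < 2 * PI) by (pose proof (Rmin_r (d / 2) PI); unfold e; lra).
  exists (e * (r * (c / 2))); split; [apply Rmult_lt_0_compat; [lra | nra]|]; intros u.
  set (f := fun t => r * ip (P (circle a r t) u) u).
  assert (Cf : forall t, continuous f t).
  { intros t; apply (continuous_scal_r (V := R_NormedModule)).
    apply (continuous_comp (fun t => P (circle a r t)) (fun A => ip (A u) u));
      [apply continuous_P_circle|].
    exact (linear_cont _ _ (is_linear_ip V u u)). }
  assert (Ef : forall p q, ex_RInt f p q)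
    by (intros p q; apply (ex_RInt_continuous (V := R_CompleteNormedModule)); intros t _; apply Cf).
  rewrite <- (is_RInt_unique (V := R_CompleteNormedModule) _ _ _ _ (is_RInt_arc u u)).
  fold f; rewrite <- (RInt_Chasles (V := R_CompleteNormedModule) f 0 e (2 * PI)) by apply Ef.
  change (e * (r * (c / 2)) * norm u ^ 2 <= RInt f 0 e + RInt f e (2 * PI)).
  assert (Hnear : e * (r * (c / 2) * norm u ^ 2) <= RInt f 0 e).
  { assert (EC : RInt (fun _ => r * (c / 2) * norm u ^ 2) 0 e = e * (r * (c / 2) * norm u ^ 2)).
    { rewrite RInt_const; unfold scal; simpl; unfold mult; simpl; ring. }
    rewrite <- EC; apply RInt_le; [lra | apply ex_RInt_const | apply Ef |].
    intros t Ht; unfold f; rewrite Rmult_assoc; apply Rmult_le_compat_l; [lra|].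
    assert (Hball : ball 0 d t).
    { change (Rabs (t - 0) < d); rewrite Rminus_0_r, Rabs_pos_eq; lra. }
    specialize (Hd t Hball).
    change (op_norm (minus (P (circle a r t)) (P (circle a r 0))) < c / 2) in Hd.
    set (B := minus (P (circle a r t)) (P (circle a r 0))) in Hd.
    assert (EB : ip (P (circle a r t) u) u = ip (P (circle a r 0) u) u + ip (B u) u).
    { unfold B; rewrite bop_minus_apply; unfold minus; rewrite ip_plus_l, ip_opp_l; ring. }
    specialize (Hcoer u).
    pose proof (ip_bound V (B u) u) as HB; pose proof (Rabs_maj2 (ip (B u) u)).
    pose proof (op_norm_bound B u) as HBn; pose proof (norm_ge_0 u).
    assert (norm (B u) * norm u <= c / 2 * norm u ^ 2) by nra.
    lra. }
  assert (Hfar : 0 <= RInt f e (2 * PI)).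
  { apply RInt_ge_0; [lra | apply Ef |]; intros t _.
    apply Rmult_le_pos; [lra | apply pos_P, circle_Omega]. }
  lra.
Qed.

Lemma arc_invertible : bop_invertible (circle_int_arc P a r).
Proof. destruct arc_coercive as [c Hc]; exact (coercive_invertible V _ c Hc). Qed.

Lemma arc_nonneg u : 0 <= ip (circle_int_arc P a r u) u.
Proof.
  destruct arc_coercive as (c & Hc & H); apply Rle_trans with (2 := H u).
  apply Rmult_le_pos; [lra | apply pow2_ge_0].
Qed.

(* The factor [w' = - i r w] turns [dz = i r e^{it} dt] into [r^2 e^{it} w dt]. *)
Lemma circle_mean_affine u w :
  let w' := scal ((0, - r) : C_AbsRing) w in
  r * circle_mean (j0 (affine_jet P a u w)) a r =
  ip (circle_int_arc P a r u) u + 2 * ip (circle_int_dz P a r w') u +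
  ip (circle_int_arc P a r w') w'.
Proof.
  intros w'.
  assert (I1 : is_RInt (fun t => r * polar (j0 (affine_jet P a u w)) a r t) 0 (2 * PI)
    (r * circle_mean (j0 (affine_jet P a u w)) a r)).
  { apply (is_RInt_scal (V := R_NormedModule)), (RInt_correct (V := R_CompleteNormedModule)),
      (ex_RInt_continuous (V := R_CompleteNormedModule)); intros t _.
    apply continuity_2d_pt_slice.
    pose proof (circle_Omega t) as Hz; rewrite circle_coord in Hz.
    exact (continuity_polar Omega a HO _ _ _ r t (proj1 (C2_on_affine_jet a u w)) Hz). }
  assert (I2 : is_RInt (fun t => r * ip (P (circle a r t) u) u +
      2 * ip (bop_cscal (Cmult Ci (Cmult r (cos t, sin t))) (P (circle a r t)) w') u +
      r * ip (P (circle a r t) w') w') 0 (2 * PI)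
    (ip (circle_int_arc P a r u) u + 2 * ip (circle_int_dz P a r w') u +
     ip (circle_int_arc P a r w') w')).
  { apply (is_RInt_plus (V := R_NormedModule)); [|apply is_RInt_arc].
    apply (is_RInt_plus (V := R_NormedModule)); [apply is_RInt_arc|].
    apply (is_RInt_scal (V := R_NormedModule)), is_RInt_dz. }
  refine (is_RInt_R_unique _ _ _ _ _ _ _ I1 I2); intros t.
  pose proof (circle_Omega t) as Hz; pose proof (adjoint_P _ Hz) as HA.
  unfold polar; rewrite circle_coord in Hz; rewrite affine_jet_value by exact Hz.
  rewrite <- circle_coord, form_affine by exact HA.
  set (A := P (circle a r t)) in *.
  change (bop_cscal (Cmult Ci (Cmult r (cos t, sin t))) A w') with
    (scal (Cmult Ci (Cmult r (cos t, sin t)) : C_AbsRing) (A w')).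
  unfold w'; rewrite !(bop_at_scal A), (@scal_assoc C_AbsRing V).
  replace (mult (Cmult Ci (Cmult r (cos t, sin t)) : C_AbsRing) ((0, - r) : C_AbsRing))
    with ((r ^ 2 * cos t, r ^ 2 * sin t) : C)
    by (apply injective_projections; simpl; ring).
  rewrite (ip_scal_conj V (0, - r) (A w)), (@scal_assoc C_AbsRing V).
  replace (mult (Cconj (0, - r) : C_AbsRing) ((0, - r) : C_AbsRing)) with (RtoC (r ^ 2))
    by (apply injective_projections; simpl; ring).
  rewrite ip_scal_real_r, (scal_coord V (r ^ 2 * cos t)), ip_plus_l, !ip_scal_real_l.
  pose proof (sin2_cos2 t) as E; unfold Rsqr in E.
  set (X := ip (A w) w).
  replace (r * (r ^ 2 * X)) with (r * (r ^ 2 * X) * (sin t * sin t + cos t * cos t))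
    by (rewrite E; ring).
  ring.
Qed.

Lemma adjoint_circle_schur : adjoint (circle_schur P a r) (circle_schur P a r).
Proof.
  apply adjoint_minus; [apply adjoint_arc|].
  apply adjoint_schur; [apply adjoint_arc | apply arc_invertible | apply adjoint_dz].
Qed.

Lemma circle_schur_le u w :
  ip (circle_schur P a r u) u <= r * circle_mean (j0 (affine_jet P a u w)) a r.
Proof.
  rewrite circle_mean_affine, (schur_complement V _ _ (circle_int_dzbar P a r));
    [|apply adjoint_arc | apply arc_invertible | apply adjoint_dz].
  unfold circle_schur; match goal with |- _ <= _ + ip (_ ?v) _ => pose proof (arc_nonneg v) end.
  lra.
Qed.

Lemma circle_schur_attained u :
  exists w, ip (circle_schur P a r u) u = r * circle_mean (j0 (affine_jet P a u w)) a r.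
Proof.
  set (x := bop_inv (circle_int_arc P a r) (circle_int_dzbar P a r u)).
  (* The factor i / r undoes - i r, so w' = - x, which annihilates the completed square. *)
  exists (scal ((0, / r) : C_AbsRing) (opp x)).
  rewrite circle_mean_affine, (@scal_assoc C_AbsRing V).
  replace (mult ((0, - r) : C_AbsRing) ((0, / r) : C_AbsRing)) with (RtoC 1)
    by (apply injective_projections; simpl; field; lra).
  rewrite (schur_complement V _ _ (circle_int_dzbar P a r));
    [|apply adjoint_arc | apply arc_invertible | apply adjoint_dz].
  fold x; replace (scal (RtoC 1 : C_AbsRing) (opp x)) with (opp x)
    by (symmetry; apply (@scal_one C_AbsRing V)).
  rewrite (@plus_opp_l V), bop_at_zero, ip_zero_l, Rplus_0_r; reflexivity.
Qed.

End Circle.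

End Curvature.

(** * Return to the operator order and conclusion *)

Lemma op_leP (V : HilbertSpace) (A B : BoundedOp V) :
  adjoint A A -> adjoint B B ->
  op_le A B <-> forall u, ip (A u) u <= ip (B u) u.
Proof.
  intros HA HB.
  assert (E : forall u, ip (minus B A u) u = ip (B u) u - ip (A u) u).
  { intros u; rewrite bop_minus_apply; unfold minus; rewrite ip_plus_l, ip_opp_l; ring. }
  unfold op_le; rewrite nonneg_opP; split.
  - intros [_ H] u; specialize (H u); rewrite E in H; lra.
  - intros H; split; [apply adjoint_minus; assumption|].
    intros u; rewrite E; specialize (H u); lra.
Qed.

Lemma affine_vec_center (V : HilbertSpace) (u w : V) (x y : R) :
  affine_vec u w (x - x) (y - y) = u.
Proof.
  unfold affine_vec; rewrite !Rminus_diag; change (0, 0) with (@zero C_AbsRing).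
  rewrite (@scal_zero_l C_AbsRing V), (@plus_zero_r V); reflexivity.
Qed.

Theorem theorem1p2 (V : HilbertSpace) (Omega : C -> Prop) (P : C -> BoundedOp V)
    (Omega_open : open Omega)
    (P_pos : forall z : C, Omega z -> End_plus (P z))
    (P_smooth : smooth_on Omega P) :
  (seminegative_curvature Omega P <->
   forall (a : C) (r : R), closed_disc_in Omega a r ->
     op_le (scal (2 * PI * r) (P a)) (circle_schur P a r)) /\
  (seminegative_curvature Omega P ->
   forall (a : C) (r s : R),
     closed_disc_in Omega a r -> closed_disc_in Omega a s -> r <= s ->
     op_le (scal (/ r) (circle_schur P a r)) (scal (/ s) (circle_schur P a s))).
Proof.
  assert (Hcurv := seminegative_curvatureP V Omega P Omega_open P_pos P_smooth).
  assert (HC2 := C2_on_affine_jet V Omega P Omega_open P_smooth).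
  assert (Hsa := adjoint_circle_schur V Omega P P_pos P_smooth).
  assert (Hle := circle_schur_le V Omega P Omega_open P_pos P_smooth).
  assert (Hatt := circle_schur_attained V Omega P Omega_open P_pos P_smooth).
  assert (Hlap := lap_affine_jet V Omega P Omega_open P_pos P_smooth).
  assert (Hscal : forall (c : R) (A : BoundedOp V) u, ip (scal c A u) u = c * ip (A u) u)
    by (intros c A u; apply ip_scal_real_l).
  assert (Hcenter : forall a, Omega a -> forall u w,
    j0 (affine_jet P a u w) (fst a) (snd a) = ip (P a u) u).
  { intros [x y] Ha u w; rewrite (affine_jet_value V Omega P P_pos _ _ _ x y Ha); simpl.
    rewrite affine_vec_center; reflexivity. }
  assert (Hin : forall a r, closed_disc_in Omega a r -> Omega a).
  { intros a r [Hr H]; apply H; unfold Cminus; rewrite Cplus_opp_r, Cmod_0; lra. }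
  assert (Hsub : seminegative_curvature Omega P -> forall a u w x y, Omega (x, y) ->
    0 <= lap (affine_jet P a u w) x y).
  { intros H a u w x y Hz; rewrite Hlap by exact Hz.
    apply Rmult_le_pos; [lra | apply (proj1 Hcurv H), Hz]. }
  assert (Hscal_sa : forall (c : R) (A : BoundedOp V), adjoint A A -> adjoint (scal c A) (scal c A))
    by (intros c A; apply adjoint_scal).
  split; [split|].
  - intros H a r Hr; pose proof (proj1 Hr) as Hr0; pose proof (Hin a r Hr) as Ha.
    apply op_leP; [apply Hscal_sa, (adjoint_P V Omega P P_pos), Ha | apply Hsa, Hr |].
    (* With the minimising w, the claim is the mean value inequality for one g, that is, comparison
       with radius 0. *)
    intros u; destruct (Hatt a r Hr u) as [w ->]; rewrite Hscal.
    pose proof (subharmonic_mean_incr Omega a _ 0 r Omega_open (HC2 a u w) Hr ltac:(lra)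
      (Hsub H a u w)) as Hm.
    rewrite circle_mean_0, (Hcenter a Ha) in Hm.
    apply (Rmult_le_compat_l r) in Hm; lra.
  - intros H; apply Hcurv; intros a u w Ha.
    assert (L : 0 <= lap (affine_jet P a u w) (fst a) (snd a)).
    { apply (mean_property_lap_ge0 Omega a _ Omega_open (HC2 a u w) Ha).
      (* For every w, <S u, u> is at most r times the mean of g, so the hypothesis gives the mean
         value inequality for all these g at once. *)
      intros r Hr; pose proof (proj1 Hr) as Hr0; rewrite (Hcenter a Ha).
      pose proof (proj1 (op_leP V _ _ (Hscal_sa _ _ (adjoint_P V Omega P P_pos a Ha))
        (Hsa a r Hr)) (H a r Hr) u) as Hm.
      rewrite Hscal in Hm; pose proof (Hle a r Hr u w).
      apply Rmult_le_reg_l with r; lra. }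
    destruct a as [x y]; rewrite (Hlap _ _ _ x y Ha) in L; cbn [fst snd] in L.
    rewrite affine_vec_center in L; lra.
  - intros H a r s Hr Hs Hrs; pose proof (proj1 Hr) as Hr0; pose proof (proj1 Hs) as Hs0.
    apply op_leP; [apply Hscal_sa, Hsa, Hr | apply Hscal_sa, Hsa, Hs |].
    (* The minimiser is taken at the larger radius s and used as a competitor at r; division by the
       radius leaves plain circular means. *)
    intros u; rewrite !Hscal; destruct (Hatt a s Hs u) as [w ->].
    pose proof (Hle a r Hr u w) as H1.
    pose proof (subharmonic_mean_incr Omega a _ r s Omega_open (HC2 a u w) Hs ltac:(lra)
      (Hsub H a u w)) as Hm.
    apply (Rmult_le_compat_l (/ r)) in H1; [|left; apply Rinv_0_lt_compat, Hr0].
    rewrite <- Rmult_assoc, Rinv_l, Rmult_1_l in H1 by lra.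
    rewrite <- Rmult_assoc, Rinv_l, Rmult_1_l by lra; lra.
Qed.
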